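(* Let $\sigma_1,\sigma_2\in\{+,-\}^{n-1}$. Then the Hohlweg--Lange associahedra $\mathrm{Ass}^{\mathrm I}_n(\sigma_1)$ and $\mathrm{Ass}^{\mathrm I}_n(\sigma_2)$ are normally isomorphic if and only if $\sigma_2$ can be obtained from $\sigma_1$ by reflections and reversals.
   Context: **Normal isomorphism.** Two complete fans in real vector spaces $V,V'$ of the same dimension are linearly isomorphic if there is a linear isomorphism $V\to V'$ sending each cone of one fan to a cone of the other. Two polytopes are normally isomorphic if their normal fans are linearly isomorphic. (For a polytope that is not full-dimensional in its ambient space, the normal fan is taken modulo its lineality space, i.e. the polytope is considered as full-dimensional in its affine hull.) **Hohlweg--Lange associahedra.** For $\sigma\in\{+,-\}^{n-1}$ let $\widetilde\sigma=(+,-,\sigma,-,+)$, a sequence of $n+3$ signs indexed by $0,1,\dots,n+2$. Let $P_{n+3}(\sigma)$ be a convex $(n+3)$-gon with vertices labelled $0,1,\dots,n+2$ from left to right (increasing first coordinate), with the vertices of sign $+$ placed above a fixed horizontal line and those of sign $-$ placed below it. For an (internal) diagonal $ij$ ($i<j$) of $P_{n+3}(\sigma)$, let $R_{ij}(\sigma)$ be the set of vertices strictly below it, and let $S_{ij}(\sigma)$ be obtained from $R_{ij}(\sigma)$ by replacing $0$ by $i$ if $0\in R_{ij}(\sigma)$ and replacing $n+2$ by $j$ if $n+2\in R_{ij}(\sigma)$. Then $$\mathrm{Ass}^{\mathrm I}_n(\sigma)=\Big\{x\in\mathbb R^{n+1}:\ \sum_{i\in S_\delta(\sigma)}x_i\ge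 \tfrac12|S_\delta(\sigma)|(|S_\delta(\sigma)|+1)\text{ for all diagonals }\delta,\ \ x_1+\cdots+x_{n+1}=\tfrac{(n+1)(n+2)}2\Big\}.$$ **Operations on sign sequences.** The reflection of $\sigma$ is $-\sigma$ (all signs changed); the reversal $\sigma^t$ is $\sigma$ with the order of its entries reversed. *)

(* Defs.v *)
From HB Require Import structures.
From mathcomp Require Import all_boot all_order all_algebra.
From mathcomp Require Import classical_sets reals.
Set Implicit Arguments.
Unset Strict Implicit.
Unset Printing Implicit Defensive.
Import Order.TTheory GRing.Theory Num.Theory.
Local Open Scope classical_set_scope.
Local Open Scope ring_scope.

(** * Normal fans and normal isomorphism *)

Section NormalIsomorphism.
Variable R : realType.

(** The linear space parallel to the affine hull of [P], that is, the span of
    all differences of points of [P]. *)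
Definition is_direction_space (V : vectType R) (P : set V) (U : {vspace V}) :=
  (forall x y, P x -> P y -> x - y \in U) /\
  (forall W : {vspace V}, (forall x y, P x -> P y -> x - y \in W) ->
    (U <= W)%VS).

Definition is_nonempty_face (V : vectType R) (P F : set V) :=
  F !=set0 /\
  exists phi : 'Hom(V, R^o),
    F = [set x | P x /\ forall y, P y -> (phi y : R) <= phi x].

(** If [U] is the direction space of [P], then the dual of [U] is the quotient
    of the dual of [V] by the functionals that are constant on [P], that is, by
    the lineality space of the normal fan of [P] in the dual of [V].  Taking the
    cones in the dual of [U] thus amounts to regarding [P] as full-dimensional
    in its affine hull. *)
Definition dual_space (V : vectType R) (U : {vspace V}) : vectType R :=
  'Hom(subvs_of U, R^o).

(** The outer normal cone of [F]: the functionals whose maximum over [P] is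
    attained at every point of [F]. *)
Definition normal_cone (V : vectType R) (U : {vspace V}) (P F : set V) :
    set (dual_space U) :=
  [set c : 'Hom(subvs_of U, R^o) |
    forall x y, F x -> P y -> (c (vsproj U (y - x)) : R) <= 0].
Arguments normal_cone {V} U P F.

Definition normal_fan (V : vectType R) (U : {vspace V}) (P : set V) :
    set (set (dual_space U)) :=
  [set C | exists2 F, is_nonempty_face P F & C = normal_cone U P F].
Arguments normal_fan {V} U P.

(** Meant for complete fans, given by their sets of cones. *)
Definition linearly_isomorphic (V V' : vectType R)
    (A : set (set V)) (A' : set (set V')) :=
  exists2 f : 'Hom(V, V'), bijective f & forall C, A C -> A' (f @` C).

Definition normally_isomorphic (V V' : vectType R) (P : set V) (P' : set V') :=
  exists (U : {vspace V}) (U' : {vspace V'}),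
    [/\ is_direction_space P U, is_direction_space P' U' &
        linearly_isomorphic (normal_fan U P) (normal_fan U' P')].

End NormalIsomorphism.

(** * Sign sequences: [true] is [+] and [false] is [-] *)

Definition reflection m (s : m.-tuple bool) : m.-tuple bool :=
  [tuple of map negb s].

Definition reversal m (s : m.-tuple bool) : m.-tuple bool :=
  [tuple of rev s].

Inductive obtained_from m (s : m.-tuple bool) : m.-tuple bool -> Prop :=
| obtained_refl : obtained_from s s
| obtained_reflection t : obtained_from s t -> obtained_from s (reflection t)
| obtained_reversal t : obtained_from s t -> obtained_from s (reversal t).

(** The signs of the labels [0, ..., n + 2], for [s] of length [n - 1]. *)
Definition extended_signs (s : seq bool) : seq bool :=
  [:: true; false] ++ s ++ [:: false; true].

(** * Hohlweg--Lange associahedra *)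

Section HohlwegLange.
Variables (R : realType) (n : nat).
Implicit Types (p : 'I_n.+3 -> 'rV[R]_2) (i j k : 'I_n.+3).

Definition xcoord (q : 'rV[R]_2) : R := q 0 0.
Definition ycoord (q : 'rV[R]_2) : R := q 0 1.

(** No point is a convex combination of the others. *)
Definition convex_position p :=
  forall k (w : 'I_n.+3 -> R),
    (forall i, 0 <= w i) -> \sum_i w i = 1 -> w k = 0 ->
    \sum_i w i *: p i <> p k.

(** [p] lists the vertices of a polygon [P_{n+3}(s)]. *)
Definition is_polygon (s : n.-1.-tuple bool) p :=
  [/\ convex_position p,
      forall i j, (i < j)%N -> xcoord (p i) < xcoord (p j) &
      exists h : R, forall k,
        if nth true (extended_signs s) k then h < ycoord (p k)
        else ycoord (p k) < h].

(** The height at abscissa [t] of the line through [p i] and [p j]. *)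
Definition line_height p i j (t : R) : R :=
  ycoord (p i) + (ycoord (p j) - ycoord (p i))
                 / (xcoord (p j) - xcoord (p i)) * (t - xcoord (p i)).

Definition below p i j k : bool :=
  ycoord (p k) < line_height p i j (xcoord (p k)).

Definition above p i j k : bool :=
  line_height p i j (xcoord (p k)) < ycoord (p k).

(** A segment between two vertices of a convex polygon is an internal diagonal
    exactly when it is not an edge, i.e. when the line through it has vertices
    on both of its sides. *)
Definition is_diagonal p i j : bool :=
  [&& (i < j)%N, [exists k, below p i j k] & [exists k, above p i j k]].

Definition R_set p i j : {set 'I_n.+3} := [set k | below p i j k].

Definition replace (a b : 'I_n.+3) (A : {set 'I_n.+3}) : {set 'I_n.+3} :=
  if a \in A then (b |: (A :\ a))%SET else A.

Definition S_set p i j : {set 'I_n.+3} :=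
  replace ord_max j (replace ord0 i (R_set p i j)).

(** The coordinates [x_1, ..., x_(n+1)] are stored at positions [0, ..., n]. *)
Definition coord_at (x : 'rV[R]_n.+1) k : R := x 0 (inord k.-1).

(** [Ass^I_n(s)], as a function of a polygon [P_{n+3}(s)] with vertices [p]. *)
Definition associahedron p : set 'rV[R]_n.+1 :=
  [set x |
    (forall i j, is_diagonal p i j ->
       (#|S_set p i j| * (#|S_set p i j| + 1))%:R / 2
         <= \sum_(k in S_set p i j) coord_at x k) /\
    \sum_(k < n.+1) x 0 k = ((n + 1) * (n + 2))%:R / 2].

End HohlwegLange.

(* Main.v *)
(** The set of vertices S_ij of a diagonal only depends on the signs, and the sets obtained in
    this way are those whose indicator word agrees with the word of lower vertices at each
    position that has a change on both of its sides.  The reversal of the coordinates and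
    x |-> (n + 2) - x then exchange the associahedra of s and of its reversal and reflection.

    Conversely, the rays of the normal fan are spanned by the vectors -1_S.  In the basis formed
    by the vectors a_m = 1_[1,m] of the initial segments they become alternating vectors with
    entries 0, 1, -1, one for each choice of a first and a last nonzero entry (two opposite ones
    when the two positions coincide).  Opposite rays come from complementary sets, and these are exactly the initial segments and their complements.  So a linear isomorphism
    of the fans permutes the lines of this basis, and it is a signed multiple of a permutation
    because a_m - a_(m+1) or its opposite is always a ray.  Declare m below m' when a_m' - a_m is
    a ray: this is the partial order whose Hasse diagram is the path 1, ..., n oriented by the
    signs.  The permutation preserves or reverses this order, hence it is the identity or the
    reversal of the path. *)

Require Import Defs.
From HB Require Import structures.
From mathcomp Require Import boolp classical_sets reals.
From mathcomp Require Import all_boot all_order all_algebra.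
From mathcomp Require Import ring lra zify.
Set Implicit Arguments.
Unset Strict Implicit.
Unset Printing Implicit Defensive.
Import Order.TTheory GRing.Theory Num.Theory.
Local Open Scope ring_scope.

(** * Vertices below a diagonal *)

Section Polygon.
Variables (R : realType) (n : nat).
Implicit Types (p : 'I_n.+3 -> 'rV[R]_2) (i j k : 'I_n.+3).

(** The four vertices may coincide, so the weight function is a sum of four indicator functions,
    whose values add up at repeated vertices. *)
Lemma no_convex_combination4 p (a c a' c' b : 'I_n.+3) (w1 w2 w3 w4 : R) :
  convex_position p -> b != a -> b != c -> b != a' -> b != c' ->
  0 <= w1 -> 0 <= w2 -> 0 <= w3 -> 0 <= w4 -> w1 + w2 + w3 + w4 = 1 ->
  w1 *: p a + w2 *: p c + w3 *: p a' + w4 *: p c' <> p b.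
Proof.
move=> hp ba bc ba' bc' h1 h2 h3 h4 hw.
pose d (a i : 'I_n.+3) : R := (i == a)%:R.
have sumd e : \sum_i d e i = 1.
  rewrite (bigD1 e) //= /d eqxx big1 ?addr0 // => i /negPf ie; by rewrite ie.
have sump e : \sum_i d e i *: p i = p e.
  rewrite (bigD1 e) //= /d eqxx scale1r big1 ?addr0 // => i /negPf ie.
  by rewrite ie scale0r.
pose w i := w1 * d a i + w2 * d c i + w3 * d a' i + w4 * d c' i.
have := hp b w; rewrite /w; move=> H E; apply: H.
- by move=> i; rewrite !addr_ge0 ?mulr_ge0 ?ler0n.
- by rewrite !big_split /= -!mulr_sumr !sumd !mulr1.
- by rewrite /d (negPf ba) (negPf bc) (negPf ba') (negPf bc') !mulr0 !addr0.
rewrite -E; under eq_bigr => i _ do rewrite !scalerDl -!scalerA.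
by rewrite !big_split /= -!scaler_sumr !sump.
Qed.

Lemma line_height_convex p i j (t : R) :
  xcoord (p i) < t -> t < xcoord (p j) ->
  exists2 l : R, 0 <= l <= 1 & t = (1 - l) * xcoord (p i) + l * xcoord (p j) /\
    line_height p i j t = (1 - l) * ycoord (p i) + l * ycoord (p j).
Proof.
set xi := xcoord _; set xj := xcoord _ => h1 h2.
have h3 : 0 < xj - xi by lra.
have h4 : xj - xi != 0 by rewrite gt_eqF.
exists ((t - xi) / (xj - xi)).
  by rewrite divr_ge0 ?ler_pdivrMr //=; lra.
rewrite /line_height -/xi -/xj; split; field => //.
Qed.

(** The vertical line through [p b] meets one chord weakly below [p b] and the other weakly above
    it, so [p b] is a convex combination of the four end points. *)
Lemma no_vertex_between p (a c a' c' b : 'I_n.+3) :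
  convex_position p ->
  (forall i j, (i < j)%N -> xcoord (p i) < xcoord (p j)) ->
  (a < b)%N -> (b < c)%N -> (a' < b)%N -> (b < c')%N ->
  line_height p a c (xcoord (p b)) <= ycoord (p b) ->
  ycoord (p b) <= line_height p a' c' (xcoord (p b)) -> False.
Proof.
move=> hp hx ab bc ab' bc'.
have [l hl [ex1 ->]] := line_height_convex (hx _ _ ab) (hx _ _ bc).
have [m hm [ex2 ->]] := line_height_convex (hx _ _ ab') (hx _ _ bc').
set H1 := (X in X <= _ -> _); set H2 := (X in _ -> _ <= X -> _) => h1 h2.
(* Equal heights are treated apart because the general weight divides by [H2 - H1]. *)
have [r hr er] : exists2 r : R, 0 <= r <= 1 & ycoord (p b) = (1 - r) * H1 + r * H2.
  have [e|ne] := eqVneq H1 H2.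
    by exists 0; [lra | rewrite -e in h2; lra].
  have h3 : 0 < H2 - H1 by rewrite subr_gt0 lt_neqAle ne; lra.
  exists ((ycoord (p b) - H1) / (H2 - H1)).
    by rewrite divr_ge0 ?ler_pdivrMr //=; lra.
  by field; rewrite gt_eqF.
case/andP: hl => hl0 hl1; case/andP: hm => hm0 hm1; case/andP: hr => hr0 hr1.
have ne (u v : 'I_n.+3) : (u < v)%N -> (u != v) /\ (v != u).
  by rewrite -!val_eqE /= => uv; split; rewrite neq_ltn uv ?orbT.
apply: (@no_convex_combination4 p a c a' c' b ((1 - r) * (1 - l))
  ((1 - r) * l) (r * (1 - m)) (r * m)) => //;
  rewrite ?(ne _ _ ab).2 ?(ne _ _ ab').2 ?(ne _ _ bc).1 ?(ne _ _ bc').1 //.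
all: rewrite ?mulr_ge0 ?subr_ge0 //.
  by ring.
apply/rowP => k; rewrite !mxE.
have [->|->] : k = 0 \/ k = 1.
  case: k => -[|[|//]] hk; [left|right]; exact: val_inj.
- change ((1 - r) * (1 - l) * xcoord (p a) + (1 - r) * l * xcoord (p c)
     + r * (1 - m) * xcoord (p a') + r * m * xcoord (p c') = xcoord (p b)).
  transitivity ((1 - r) * ((1 - l) * xcoord (p a) + l * xcoord (p c)) +
    r * ((1 - m) * xcoord (p a') + m * xcoord (p c'))); first by ring.
  by rewrite -ex1 -ex2; ring.
change ((1 - r) * (1 - l) * ycoord (p a) + (1 - r) * l * ycoord (p c)
     + r * (1 - m) * ycoord (p a') + r * m * ycoord (p c') = ycoord (p b)).
by rewrite er /H1 /H2; ring.
Qed.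

Definition sign (s : n.-1.-tuple bool) (k : nat) := nth true (extended_signs s) k.

Lemma sign_first (s : n.-1.-tuple bool) : sign s 0 /\ sign s 1 = false.
Proof. by []. Qed.

Lemma sign_last (s : n.-1.-tuple bool) : (1 <= n)%N ->
  sign s n.+1 = false /\ sign s n.+2.
Proof.
move=> n0; have E (k : nat) : sign s k.+2 = nth true (s ++ [:: false; true]) k by [].
have -> : n.+1 = n.-1.+2 by lia.
by rewrite !E !nth_cat size_tuple ltnn subnn ltnNge leqnSn subSnn.
Qed.

Lemma sign_mid (s : n.-1.-tuple bool) (k : nat) : (0 < k)%N -> (k < n)%N ->
  sign s k.+1 = nth true s k.-1.
Proof.
move=> k0 kn; rewrite /sign /extended_signs /= -(prednK k0) /= nth_cat size_tuple.
by rewrite ifT //; lia.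
Qed.

(* A vertex below the horizontal line is below the chord from [0] to [n + 2], and one above it is
   above the chord from [1] to [n + 1]; were it on the wrong side of the chord from [a] to [c], it
   would lie between two chords. *)
Lemma vertex_between (s : n.-1.-tuple bool) p (a b c : 'I_n.+3) : (1 <= n)%N ->
  is_polygon s p -> (a < b)%N -> (b < c)%N ->
  if sign s b then line_height p a c (xcoord (p b)) < ycoord (p b)
  else ycoord (p b) < line_height p a c (xcoord (p b)).
Proof.
move=> n0 [hp hx [h hh]] ab bc.
have bnd (i j : 'I_n.+3) (Q : R -> Prop) : (i < b)%N -> (b < j)%N ->
    (forall u v l, 0 <= l -> 0 <= 1 - l -> Q u -> Q v -> Q ((1 - l) * u + l * v)) ->
    Q (ycoord (p i)) -> Q (ycoord (p j)) -> Q (line_height p i j (xcoord (p b))).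
  move=> ib bj HQ Qi Qj.
  have [l hl [_ ->]] := line_height_convex (hx _ _ ib) (hx _ _ bj).
  by apply: HQ => //; lra.
have [s0 s1] := sign_first s; have [sn1 sn2] := sign_last s n0.
have := hh b; rewrite -/(sign s b); case: ifP => sb hb; rewrite ltNge; apply/negP => hl.
  have b1 : (b != 1 :> nat) by apply: contraTneq sb => ->; rewrite s1.
  have bn1 : (b != n.+1 :> nat) by apply: contraTneq sb => ->; rewrite sn1.
  have l1 : (1 < n.+3)%N by lia.
  have ln : (n.+1 < n.+3)%N by lia.
  have c3 := ltn_ord c.
  have h1 : (Ordinal l1 < b)%N by rewrite /=; lia.
  have h2 : (b < Ordinal ln)%N by rewrite /=; lia.
  apply: (no_vertex_between hp hx h1 h2 ab bc) hl.
  apply: le_trans (ltW hb); apply: (bnd _ _ (fun t => t <= h)) => //.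
  - by move=> u v l l0 l1' uh vh; nra.
  - by have := hh (Ordinal l1); rewrite -/(sign s _) /= => /ltW.
  - by have := hh (Ordinal ln); rewrite -/(sign s _) /= sn1 => /ltW.
have b0 : (b != 0 :> nat) by apply: contraFneq sb => ->; rewrite s0.
have bn2 : (b != n.+2 :> nat) by apply: contraFneq sb => ->; rewrite sn2.
have c3 := ltn_ord c.
have h1 : (@ord0 n.+2 < b)%N by rewrite /=; lia.
have h2 : (b < @ord_max n.+2)%N by rewrite /=; lia.
apply: (no_vertex_between hp hx ab bc h1 h2) hl _.
apply: (le_trans (ltW hb)); apply: (bnd _ _ (fun t => h <= t)) => //.
- by move=> u v l l0 l1' uh vh; nra.
- by have := hh ord0; rewrite -/(sign s _) /= => /ltW.
- by have := hh ord_max; rewrite -/(sign s _) /= sn2 => /ltW.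
Qed.

(** Both sides express the orientation of one triangle: each vertical distance times the width of
    its chord is the same determinant. A vertex left of the chord is thus brought to the situation
    of [vertex_between]. *)
Lemma line_height_left p (i j k : 'I_n.+3) :
  xcoord (p k) < xcoord (p i) -> xcoord (p i) < xcoord (p j) ->
  (ycoord (p k) < line_height p i j (xcoord (p k))) =
  (line_height p k j (xcoord (p i)) < ycoord (p i)) /\
  (line_height p i j (xcoord (p k)) < ycoord (p k)) =
  (ycoord (p i) < line_height p k j (xcoord (p i))).
Proof.
rewrite /line_height; move: (xcoord (p k)) (xcoord (p i)) (xcoord (p j)).
move: (ycoord (p k)) (ycoord (p i)) (ycoord (p j)) => yk yi yj xk xi xj h1 h2.
have e1 : 0 < xj - xi by lra.
have e2 : 0 < xj - xk by lra.
have E : (yi + (yj - yi) / (xj - xi) * (xk - xi) - yk) * (xj - xi) =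
         (yi - (yk + (yj - yk) / (xj - xk) * (xi - xk))) * (xj - xk).
  by field; rewrite !gt_eqF.
split.
  by rewrite -subr_gt0 -(pmulr_lgt0 _ e1) E pmulr_lgt0 // subr_gt0.
by rewrite -subr_lt0 -(pmulr_llt0 _ e1) E pmulr_llt0 // subr_lt0.
Qed.

Lemma line_height_right p (i j k : 'I_n.+3) :
  xcoord (p i) < xcoord (p j) -> xcoord (p j) < xcoord (p k) ->
  (ycoord (p k) < line_height p i j (xcoord (p k))) =
  (line_height p i k (xcoord (p j)) < ycoord (p j)) /\
  (line_height p i j (xcoord (p k)) < ycoord (p k)) =
  (ycoord (p j) < line_height p i k (xcoord (p j))).
Proof.
rewrite /line_height; move: (xcoord (p k)) (xcoord (p i)) (xcoord (p j)).
move: (ycoord (p k)) (ycoord (p i)) (ycoord (p j)) => yk yi yj xk xi xj h1 h2.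
have e1 : 0 < xj - xi by lra.
have e2 : 0 < xk - xi by lra.
have E : (yi + (yj - yi) / (xj - xi) * (xk - xi) - yk) * (xj - xi) =
         (yj - (yi + (yk - yi) / (xk - xi) * (xj - xi))) * (xk - xi).
  by field; rewrite !gt_eqF.
split.
  by rewrite -subr_gt0 -(pmulr_lgt0 _ e1) E pmulr_lgt0 // subr_gt0.
by rewrite -subr_lt0 -(pmulr_llt0 _ e1) E pmulr_llt0 // subr_lt0.
Qed.

(** The orientation of three vertices is decided by the sign of the middle one, so the answer is the
    sign of the middle vertex among [i], [j], [k]. *)
Lemma below_sign (s : n.-1.-tuple bool) p (i j k : 'I_n.+3) : (1 <= n)%N ->
  is_polygon s p -> (i < j)%N ->
  below p i j k = if (k < i)%N then sign s i else if k == i then false else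
    if (k < j)%N then ~~ sign s k else if k == j then false else sign s j.
Proof.
move=> n0 hP ij; have [_ hx _] := hP; rewrite /below -!val_eqE /=.
have xij := hx _ _ ij.
case: (ltngtP k i) => [ki|ik|/val_inj ->].
- rewrite (line_height_left (hx _ _ ki) xij).1.
  by have := vertex_between n0 hP ki ij; case: ifP => // _ /ltW; rewrite leNgt => /negPf.
- case: (ltngtP k j) => [kj|jk|/val_inj ->].
  + have := vertex_between n0 hP ik kj; case: ifP => // _ /ltW; by rewrite leNgt => /negPf.
  + rewrite (line_height_right xij (hx _ _ jk)).1.
    by have := vertex_between n0 hP ij jk; case: ifP => // _ /ltW; rewrite leNgt => /negPf.
  rewrite /line_height divfK ?subr_eq0 ?gt_eqF //; first by rewrite addrC subrK ltxx.
by rewrite /line_height subrr mulr0 addr0 ltxx.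
Qed.

Lemma above_sign (s : n.-1.-tuple bool) p (i j k : 'I_n.+3) : (1 <= n)%N ->
  is_polygon s p -> (i < j)%N ->
  above p i j k = [&& k != i, k != j & ~~ below p i j k].
Proof.
move=> n0 hP ij; have [_ hx _] := hP; rewrite /below /above -!val_eqE /=.
have xij := hx _ _ ij.
have T (u v : R) (b : bool) : (if b then u < v else v < u) -> (u < v) = ~~ (v < u).
  by case: b => h; rewrite h ?(lt_gtF h).
case: (ltngtP k i) => [ki|ik|/val_inj ->] /=.
- rewrite (ltn_eqF (ltn_trans ki ij)) /=.
  rewrite (line_height_left (hx _ _ ki) xij).1 (line_height_left (hx _ _ ki) xij).2.
  have := vertex_between n0 hP ki ij => /T ->; by rewrite negbK.
- case: (ltngtP k j) => [kj|jk|/val_inj ->] /=.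
  + by have := vertex_between n0 hP ik kj => /T.
  + rewrite (line_height_right xij (hx _ _ jk)).1 (line_height_right xij (hx _ _ jk)).2.
    have := vertex_between n0 hP ij jk => /T ->; by rewrite negbK.
  rewrite /line_height divfK ?subr_eq0 ?gt_eqF //; first by rewrite addrC subrK ltxx.
by rewrite /line_height subrr mulr0 addr0 ltxx.
Qed.

End Polygon.

(** * The sets of the diagonals *)

Section Family.
Variable (n : nat).
Implicit Types (s : n.-1.-tuple bool) (S T : {set 'I_n.+1}) (k : 'I_n.+1).

(* The element [k] of ['I_n.+1] stands for the label [k + 1], whose sign is the entry [k - 1] of
   [s].  The last two alternatives make the condition void for [k = 0] and [k = n], where this
   entry does not exist. *)
Definition fam s : {pred {set 'I_n.+1}} := fun S =>
  [forall k, [|| (k \in S) == ~~ nth true s k.-1,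
     [forall a : 'I_n.+1, (a <= k)%N ==> ((a \in S) == (k \in S))] |
     [forall a : 'I_n.+1, (k <= a)%N ==> ((a \in S) == (k \in S))]]].

Lemma famP s S : reflect (forall k, [\/ (k \in S) = ~~ nth true s k.-1,
    forall a : 'I_n.+1, (a <= k)%N -> (a \in S) = (k \in S) |
    forall a : 'I_n.+1, (k <= a)%N -> (a \in S) = (k \in S)]) (S \in fam s).
Proof.
apply: (iffP forallP) => H k; have := H k.
  case/or3P => [/eqP ?|/forallP h|/forallP h]; first by constructor 1.
    by constructor 2 => a ak; apply/eqP; apply: (implyP (h a)).
  by constructor 3 => a ak; apply/eqP; apply: (implyP (h a)).
case=> [->|h|h]; first by rewrite eqxx.
  by apply/or3P; constructor 2; apply/forallP => a; apply/implyP => /h ->.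
by apply/or3P; constructor 3; apply/forallP => a; apply/implyP => /h ->.
Qed.

End Family.

Section Removahedron.
Variables (R : realType) (n : nat).
Implicit Types (D : {pred {set 'I_n.+1}}) (S T : {set 'I_n.+1}) (x : 'rV[R]_n.+1).

Definition triangle (m : nat) : R := (m * (m + 1))%:R / 2.

Definition sumS S x : R := \sum_(i in S) x 0 i.

(** The permutahedron with only the inequalities of the sets in [D] kept. *)
Definition removahedron D : set 'rV[R]_n.+1 := [set x |
  (forall S, S \in D -> triangle #|S| <= sumS S x) /\
  sumS [set: 'I_n.+1] x = triangle n.+1]%classic.

End Removahedron.

Section Associahedron.
Variables (R : realType) (n : nat).
Hypothesis n_gt0 : (1 <= n)%N.
Variables (s : n.-1.-tuple bool) (p : 'I_n.+3 -> 'rV[R]_2).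
Hypothesis hP : is_polygon s p.

(* Membership of the label [k] in [S_set p i j]. *)
Definition word (i j k : nat) : bool :=
  if (k <= i)%N then sign s i else if (j <= k)%N then sign s j else ~~ sign s k.

Fact label_subproof (k : 'I_n.+1) : (k.+1 < n.+3)%N.
Proof. by rewrite !ltnS ltnW. Qed.
Definition label k := Ordinal (label_subproof k).

Lemma label_inj : injective label.
Proof. by move=> a b /(congr1 val) [] /val_inj. Qed.

Definition wordset (i j : nat) := [set k : 'I_n.+1 | word i j k.+1].

Lemma in_R_set (i j v : 'I_n.+3) : (i < j)%N -> (v \in R_set p i j) =
  ((v < i)%N && sign s i) || ((i < v < j)%N && ~~ sign s v) || ((j < v)%N && sign s j).
Proof.
move=> ij; rewrite inE (below_sign v n_gt0 hP ij) -!val_eqE /=.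
by case: (ltngtP v i) => h1; case: (ltngtP v j) => h2 //=; rewrite ?orbF //; lia.
Qed.

Lemma in_replace (a b v : 'I_n.+3) (A : {set 'I_n.+3}) : (v \in replace a b A) =
  ((a \in A) && ((v == b) || ((v != a) && (v \in A)))) || ((a \notin A) && (v \in A)).
Proof. by rewrite /replace; case: ifP => aA; rewrite ?inE ?orbF. Qed.

(** The label 0 is below the diagonal exactly when [0 < i] and [i] has sign +, and similarly at the
    other end. The replacements thus put [i] and [j] in the set according to their own signs, which
    is why [word] takes the sign of [i] up to and including [i]. *)
Lemma in_S_set (i j v : 'I_n.+3) : (i < j)%N ->
  (v \in S_set p i j) = [&& (0 < v)%N, (v < n.+2)%N & word i j v].
Proof.
move=> ij; have [s0 s1] := sign_first s; have [sn1 sn2] := sign_last s n_gt0.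
have i3 := ltn_ord i; have j3 := ltn_ord j; have v3 := ltn_ord v.
have e0 : (ord0 \in R_set p i j) = (0 < i)%N && sign s i.
  by rewrite in_R_set //= !orbF.
have e1 : (ord_max \in replace ord0 i (R_set p i j)) = (j < n.+2)%N && sign s j.
  rewrite in_replace !in_R_set // -!val_eqE /=.
  have -> : (n.+2 == i) = false by lia.
  have -> : (n.+2 < i)%N = false by lia.
  have -> : (n.+2 < j)%N = false by lia.
  by rewrite andbF /= -andb_orl orbN.
rewrite /S_set in_replace e1 in_replace e0 !in_R_set // -!val_eqE /= /word.
have ai : (0 < i)%N || sign s i by case: posnP => // ->; rewrite s0.
have bj : (j < n.+2)%N || sign s j.
  by case: (ltnP j n.+2) => // jn; rewrite (_ : nat_of_ord j = n.+2) ?sn2 //; lia.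
have -> : (v == n.+2 :> nat) = ~~ (v < n.+2)%N by lia.
have -> : (v == 0 :> nat) = ~~ (0 < v)%N by lia.
case: (ltngtP v i) => [vi|iv|vi].
- have [-> ->] : (0 < i)%N = true /\ (v < n.+2)%N = true by lia.
  rewrite (ltn_trans vi ij) (ltn_eqF (ltn_trans vi ij)) (ltnNge j v) (ltnW (ltn_trans vi ij)) /=.
  by case: (0 < v)%N (sign s i) (sign s j) (j < n.+2)%N => [] [] [] [].
- case: (ltngtP v j) => [vj|jv|vj].
  + have [-> ->] : (0 < v)%N = true /\ (v < n.+2)%N = true by lia.
    by case: (sign s i) (sign s j) (sign s v) (0 < i)%N (j < n.+2)%N ai bj => [] [] [] [] [].
  + have [-> ->] : (0 < v)%N = true /\ (j < n.+2)%N = true by lia.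
    by case: (sign s i) (sign s j) (0 < i)%N (v < n.+2)%N ai => [] [] [] [].
  + have [-> ->] : (0 < v)%N = true /\ (v < n.+2)%N = (j < n.+2)%N by lia.
    by case: (sign s i) (sign s j) (0 < i)%N (j < n.+2)%N ai bj => [] [] [] [].
have [-> ->] : (0 < v)%N = (0 < i)%N /\ (v < n.+2)%N = true by lia.
rewrite vi ij (ltn_eqF ij) (ltnNge j i) (ltnW ij) /=.
by case: (sign s i) (sign s j) (0 < i)%N (j < n.+2)%N ai bj => [] [] [] [].
Qed.
Lemma S_setE (i j : 'I_n.+3) : (i < j)%N -> S_set p i j = label @: wordset i j.
Proof.
move=> ij; apply/setP => v; rewrite in_S_set //; apply/idP/imsetP.
  case/and3P => v0 vn w.
  have h : (v.-1 < n.+1)%N by lia.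
  exists (Ordinal h); first by rewrite inE /= prednK.
  by apply: val_inj; rewrite /= prednK.
by move=> [k]; rewrite inE => w ->; rewrite /= w andbT ltnS.
Qed.

Lemma wordset_fam (i j : nat) : wordset i j \in fam s.
Proof.
apply/famP => k; rewrite /wordset; have [ki|ik] := leqP k.+1 i.
  by constructor 2 => a ak; rewrite !inE /word ki (leq_trans _ ki).
have [jk|kj] := leqP j k.+1.
  constructor 3 => a ka; rewrite !inE /word jk (leq_trans jk) //.
  by rewrite ifF ?ifF //; lia.
have [k0|k0] := posnP k.
  by constructor 2 => a; rewrite k0 leqn0 => /eqP a0; have -> // : a = k; apply: val_inj; rewrite /= a0 k0.
have [kn|kn] := leqP n k.
  have kn' : (k = n :> nat) by have := ltn_ord k; lia.
  constructor 3 => a; rewrite kn' => an; have -> // : a = k; apply: val_inj; have := ltn_ord a; rewrite /= kn'; lia.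
by constructor 1; rewrite inE /word leqNgt ik /= leqNgt kj /= sign_mid.
Qed.

(** The prefix and the suffix share the position [j.-1] unless one of them is empty. This gives
    [i < j] for a nontrivial set in [fam_wordset]. *)
Lemma prefix_suffix_const (S : {set 'I_n.+1}) (i j : nat) (b c : bool) :
  (j <= i)%N -> (forall k : 'I_n.+1, (k < i)%N -> (k \in S) = b) ->
  (forall k : 'I_n.+1, (j <= k.+1)%N -> (k \in S) = c) ->
  exists d, forall k, (k \in S) = d.
Proof.
move=> ji pre suf; have [i0|i0] := posnP i.
  by exists c => k; apply: suf; rewrite (leq_trans ji) ?i0.
have [jn|nj] := leqP j n.+1; last first.
  by exists b => k; apply: pre; rewrite (leq_trans (ltn_ord k)) // (leq_trans (ltnW nj)).
have hj : (j.-1 < n.+1)%N by case: (j) jn.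
have bc : b = c.
  rewrite -(pre (Ordinal hj)) ?(suf (Ordinal hj)) //=; first exact: leqSpred.
  by case: (j) ji.
exists b => k; have [/pre //|ik] := ltnP k i.
by rewrite bc; apply: suf; rewrite (leq_trans ji) // leqW.
Qed.

(** Take for [i] the last label up to which the letters are constant and equal to the sign of [i],
    with 0 as default, and for [j] the first label with the mirrored property, with [n + 2] as
    default. A position between them whose letter were its own sign would end a constant prefix or
    start a constant suffix, against the choice of [i] or [j]. *)
Lemma fam_wordset (S : {set 'I_n.+1}) : S \in fam s -> S != set0 -> S != setT ->
  exists i j : 'I_n.+3, (i < j)%N /\ S = wordset i j.
Proof.
move=> /famP hS S0 ST.
have [s0 s1] := sign_first s; have [sn1 sn2] := sign_last s n_gt0.
have [P PE] : exists P : pred 'I_n.+3, forall v, P v = (v == ord0) || [exists k, (label k == v) &&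
  (((k \in S) == sign s v) && [forall a : 'I_n.+1, (a <= k)%N ==> ((a \in S) == (k \in S))])].
  by eexists.
have [Q QE] : exists Q : pred 'I_n.+3, forall v, Q v = (v == ord_max) || [exists k, (label k == v) &&
  (((k \in S) == sign s v) && [forall a : 'I_n.+1, (k <= a)%N ==> ((a \in S) == (k \in S))])].
  by eexists.
have P0 : P ord0 by rewrite PE eqxx.
have Qm : Q ord_max by rewrite QE eqxx.
have [i Pi imax] : exists2 i : 'I_n.+3, P i & forall v, P v -> (v <= i)%N.
  by case: (arg_maxnP (fun v : 'I_n.+3 => v : nat) P0) => i Pi imax; exists i.
have [j Qj jmin] : exists2 j : 'I_n.+3, Q j & forall v, Q v -> (j <= v)%N.
  by case: (arg_minnP (fun v : 'I_n.+3 => v : nat) Qm) => j Qj jmin; exists j.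
have pre (k : 'I_n.+1) : (k < i)%N -> (k \in S) = sign s i.
  move=> ki; move: Pi; rewrite PE; case: eqP => [i0|_ /=]; first by rewrite i0 in ki.
  case/existsP => l /and3P [/eqP li /eqP <- /forallP h].
  by apply/eqP; apply: (implyP (h k)); rewrite -li /= in ki.
have suf (k : 'I_n.+1) : (j <= k.+1)%N -> (k \in S) = sign s j.
  move=> ki; move: Qj; rewrite QE; case: eqP => [j0|_ /=].
    by move: (ltn_ord k) ki; rewrite j0 /= => /leq_trans h /h; rewrite ltnn.
  case/existsP => l /and3P [/eqP li /eqP <- /forallP h].
  by apply/eqP; apply: (implyP (h k)); rewrite -li /= in ki.
exists i, j; have ij : (i < j)%N.
  rewrite ltnNge; apply/negP => ji.
  have [[] d] := prefix_suffix_const ji pre suf.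
    by move/eqP: ST; apply; apply/setP => k; rewrite d inE.
  by move/eqP: S0; apply; apply/setP => k; rewrite d inE.
split=> //; apply/setP => k; rewrite inE /word.
case: ltnP => [ki|ik]; first by rewrite pre.
case: leqP => [jk|kj]; first by rewrite suf.
apply/eqP; apply: contraT => ne.
have sk : (k \in S) = sign s k.+1 by case: (k \in S) (sign s k.+1) ne => [] [].
have nopre : ~ (forall a : 'I_n.+1, (a <= k)%N -> (a \in S) = (k \in S)).
  move=> h; have /imax : P (label k).
    rewrite PE; apply/orP; right; apply/existsP; exists k; rewrite eqxx /= sk eqxx /=.
    by apply/forallP => a; apply/implyP => /h ->; rewrite sk.
  by rewrite /= leqNgt ltnS ik.
have nosuf : ~ (forall a : 'I_n.+1, (k <= a)%N -> (a \in S) = (k \in S)).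
  move=> h; have /jmin : Q (label k).
    rewrite QE; apply/orP; right; apply/existsP; exists k; rewrite eqxx /= sk eqxx /=.
    by apply/forallP => a; apply/implyP => /h ->; rewrite sk.
  by rewrite /= leqNgt kj.
case: (hS k) => // e; have [k0|k0] := posnP k.
  case: nopre => a; rewrite k0 leqn0 => /eqP a0.
  by have -> : a = k by apply: val_inj; rewrite /= a0 k0.
have [kn|kn] := leqP n k; last by move: ne; rewrite e sign_mid // eqxx.
case: nosuf => a ka; have -> // : a = k; apply/val_inj/eqP.
by rewrite eqn_leq ka (leq_trans _ kn) // -ltnS ltn_ord.
Qed.

(** All other vertices are on one side of an edge. A nontrivial member of [fam s] therefore comes
    from a diagonal. *)
Lemma not_diagonal (i j : 'I_n.+3) : (i < j)%N -> ~~ is_diagonal p i j ->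
  wordset i j = set0 \/ wordset i j = setT.
Proof.
move=> ij; have [s0 s1] := sign_first s; have [sn1 sn2] := sign_last s n_gt0.
have i3 := ltn_ord i; have j3 := ltn_ord j.
rewrite /is_diagonal ij /= negb_and => /orP [/existsPn h|/existsPn h].
  have R0 : R_set p i j = set0 by apply/setP => v; rewrite !inE; apply/negbTE/h.
  have S0 : S_set p i j = set0.
    by apply/setP => v; rewrite /S_set !in_replace R0 !inE.
  left; apply/eqP; rewrite -cards_eq0 -(card_imset _ label_inj) -S_setE //.
  by rewrite S0 cards0.
have bel v : (v != i) -> (v != j) -> v \in R_set p i j.
  by move=> vi vj; move: (h v); rewrite (above_sign _ n_gt0 hP ij) vi vj inE /= negbK.
right; apply/setP => k; have k3 := ltn_ord k; rewrite !inE /word.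
case: ltnP => ki.
  have := bel ord0; rewrite in_R_set // -!val_eqE /= => H.
  by case: (sign s i) H => // H; lia.
case: leqP => kj.
  have := bel ord_max; rewrite in_R_set // -!val_eqE /= => H.
  by case: (sign s j) H => // H; lia.
have := bel (label k); rewrite in_R_set // -!val_eqE /= => H.
by case: (sign s k.+1) H => // H; lia.
Qed.

Lemma sum_S_set (i j : 'I_n.+3) (x : 'rV[R]_n.+1) : (i < j)%N ->
  \sum_(k in S_set p i j) coord_at x k = sumS (wordset i j) x.
Proof.
move=> ij; rewrite S_setE // big_imset /=; last by move=> a b _ _ /label_inj.
apply: eq_bigr => k _; rewrite /coord_at /=; congr (x _ _); exact: inord_val.
Qed.

Lemma associahedronE : associahedron p = removahedron (fam s).
Proof.
have E x : sumS [set: 'I_n.+1] x = \sum_(k < n.+1) x 0 k.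
  by apply: eq_bigl => k; rewrite inE.
(* The inequalities of the two trivial sets are equalities on the hyperplane, so their presence in
   [fam s] does no harm. *)
have T0 (x : 'rV[R]_n.+1) (S : {set 'I_n.+1}) : \sum_(k < n.+1) x 0 k = triangle R n.+1 -> S = set0 \/ S = setT ->
    triangle R #|S| <= sumS S x.
  move=> ex [->|->]; last by rewrite E ex cardsT card_ord.
  by rewrite /triangle cards0 mul0n mul0r /sumS big_set0.
have e (x : 'rV[R]_n.+1) : sumS setT x = triangle R n.+1 <->
    \sum_(k < n.+1) x 0 k = ((n + 1) * (n + 2))%:R / 2.
  by rewrite E /triangle !addn1 addn2.
apply/seteqP; split=> x /=.
  case=> h ex; split=> [S hS|]; last exact/e.
  have ex' : \sum_(k < n.+1) x 0 k = triangle R n.+1 by rewrite -E; apply/e.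
  have [->|S0] := eqVneq S set0; first by apply: T0 => //; left.
  have [->|ST] := eqVneq S setT; first by apply: T0 => //; right.
  have [i [j [ij ->]]] := fam_wordset hS S0 ST.
  have [d|/(not_diagonal ij)] := boolP (is_diagonal p i j); last exact: T0.
  have := h _ _ d; rewrite sum_S_set // S_setE // card_imset //; exact: label_inj.
case=> h ex; split=> [i j|]; last exact/e.
move=> /and3P [ij _ _]; rewrite sum_S_set // S_setE // card_imset; last exact: label_inj.
exact/h/wordset_fam.
Qed.

End Associahedron.

(** * Facets and rays of the normal fan *)

Section Sum.
Variables (R : realType) (n : nat).
Implicit Types (S T : {set 'I_n.+1}) (x : 'rV[R]_n.+1).

Fact sumS_is_linear S : linear (sumS S : 'rV[R]_n.+1 -> R^o).
Proof.
move=> a x y; rewrite /sumS scaler_sumr -big_split.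
by apply: eq_bigr => i _; rewrite !mxE.
Qed.
HB.instance Definition _ S :=
  GRing.isLinear.Build R 'rV[R]_n.+1 R^o _ (sumS S : 'rV[R]_n.+1 -> R^o) (sumS_is_linear S).

Definition unit_diff i j : 'rV[R]_n.+1 := delta_mx 0 i - delta_mx 0 j.

Lemma sumSD S x y : sumS S (x + y) = sumS S x + sumS S y.
Proof. exact: (linearD (sumS S : 'rV[R]_n.+1 -> R^o)). Qed.

Lemma sumSB S x y : sumS S (x - y) = sumS S x - sumS S y.
Proof. exact: (linearB (sumS S : 'rV[R]_n.+1 -> R^o)). Qed.

Lemma sumSZ S a x : sumS S (a *: x) = a * sumS S x.
Proof. exact: (linearZ_LR (sumS S : {linear 'rV[R]_n.+1 -> R^o})). Qed.

Lemma sumS_delta S i : sumS S (delta_mx 0 i : 'rV[R]_n.+1) = (i \in S)%:R.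
Proof.
rewrite /sumS; have [iS|iS] := boolP (i \in S).
  rewrite (bigD1 i) //= big1 ?addr0 ?mxE ?eqxx // => j /andP [_ ji].
  by rewrite !mxE (negPf ji) andbF.
rewrite big1 // => j jS; rewrite !mxE eqxx /=.
by case: (j =P i) jS iS => // -> ->.
Qed.

Lemma sumS_unit_diff S i j : sumS S (unit_diff i j) = (i \in S)%:R - (j \in S)%:R.
Proof. by rewrite sumSB !sumS_delta. Qed.

(* A point in the relative interior of the facet of [S], and the center of the polytope when [S]
   is empty. *)
Definition base S : 'rV[R]_n.+1 :=
  \row_i if i \in S then (#|S| + 1)%:R / 2 else (#|S| + n.+2)%:R / 2.

Lemma sumS_base S T : sumS T (base S) =
  (#|T :&: S| * (#|S| + 1) + #|T :\: S| * (#|S| + n.+2))%:R / 2.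
Proof.
rewrite /sumS (big_setID S) /= natrD !natrM mulrDl; congr (_ + _).
  under eq_bigr => i do rewrite inE => /andP [_ iS]; rewrite ?mxE ?iS.
  rewrite (eq_bigr (fun=> (#|S| + 1)%:R / 2)); last first.
    by move=> i; rewrite inE mxE => /andP [_ ->].
  by rewrite sumr_const -[LHS]mulr_natl mulrA.
rewrite (eq_bigr (fun=> (#|S| + n.+2)%:R / 2)); last first.
  by move=> i; rewrite inE mxE => /andP [/negPf -> _].
by rewrite sumr_const -[LHS]mulr_natl mulrA.
Qed.

Lemma sumS_base_self S : sumS S (base S) = triangle R #|S|.
Proof. by rewrite sumS_base setIid setDv cards0 mul0n addn0. Qed.

Lemma sumS_base_total S : sumS setT (base S) = triangle R n.+1.
Proof.
rewrite sumS_base setTI setTD /triangle; congr (_%:R / 2).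
have := cardsC S; rewrite card_ord; move: #|S| #|~: S| => a b; nia.
Qed.

(** With [t1], [t2], [a], [b] the sizes of the four cells cut out by [T] and [S], twice the slack is
    [t1 * a + 2 * a * t2 + t2 * b], a natural number that vanishes only if [T] is empty, full or
    equal to [S]. *)
Lemma sumS_base_slack S T : T != set0 -> T != setT -> T != S ->
  triangle R #|T| + 1 / 2 <= sumS T (base S).
Proof.
move=> T0 TT TS; rewrite sumS_base /triangle -mulrDl natr1 ler_pM2r ?invr_gt0 // ler_nat.
have e1 := cardsID S T; have e2 := cardsID T S; have e3 := cardsC (T :|: S).
have e4 := cardsUI T S.
rewrite setIC in e2; rewrite card_ord in e3.
have h1 : (0 < #|T :&: S| + #|T :\: S|)%N by rewrite e1 card_gt0.
have h2 : (0 < #|T :\: S| + #|S :\: T|)%N.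
  rewrite lt0n addn_eq0 !cards_eq0 !setD_eq0; apply: contra TS => h; by rewrite eqEsubset.
have h3 : (0 < #|S :\: T| + #|~: (T :|: S)|)%N.
  rewrite lt0n addn_eq0 !cards_eq0 setD_eq0; apply: contra TT => /andP [h].
  by rewrite (setUidPl h) -setCT (inj_eq (@setC_inj _)).
move: e1 e2 e3 e4 h1 h2 h3; set t1 := #|T :&: S|; set t2 := #|T :\: S|.
set a := #|S :\: T|; set b := #|~: _|; move: #|T| #|S| #|_ :|: _| t1 t2 a b.
move=> t s u t1 t2 a b e1 e2 e3 e4 h1 h2 h3.
have -> : n.+2 = (t1 + a + t2 + b).+1 by lia.
rewrite -e1 -e2.
have : (0 < t1 * a + 2 * a * t2 + t2 * b)%N.
  by move: h1 h2 h3; clear; case: a => [|a]; case: t1 => [|t1]; case: t2 => [|t2]; nia.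
by clear; nia.
Qed.

End Sum.

Section Geometry.
Variables (R : realType) (n : nat) (D : {pred {set 'I_n.+1}}).
Implicit Types (S T : {set 'I_n.+1}) (x y : 'rV[R]_n.+1).
Local Notation P := (@removahedron R n D).

(** The slack of one half absorbs the displacement in all constraints but that of [S], for which the
    hypothesis makes the displacement point inwards. The constraints of all sets are checked, so [D]
    is arbitrary. *)
Lemma base_unit_diff S i j : (i \in S) || (j \notin S) -> P (base R S + 2^-1 *: unit_diff R i j).
Proof.
move=> ij; split=> [T _|]; rewrite sumSD sumSZ sumS_unit_diff; last first.
  by rewrite !in_setT subrr mulr0 addr0 sumS_base_total.
have [->|T0] := eqVneq T set0.
  by rewrite !in_set0 subrr mulr0 addr0 /sumS big_set0 /triangle cards0 mul0n mul0r.
have [->|TT] := eqVneq T setT.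
  by rewrite !in_setT subrr mulr0 addr0 sumS_base_total cardsT card_ord.
have [->|TS] := eqVneq T S.
  rewrite sumS_base_self lerDl mulr_ge0 ?invr_ge0 ?ler0n // subr_ge0 ler_nat.
  by case: (i \in S) (j \in S) ij => [] [].
have := sumS_base_slack R T0 TT TS; case: (i \in T) (j \in T) => [] [] /=; lra.
Qed.

Lemma base_in S : P (base R S).
Proof.
have := @base_unit_diff S ord0 ord0; rewrite /unit_diff subrr scaler0 addr0 orbN; exact.
Qed.

Lemma unit_diff_direction (W : {vspace 'rV[R]_n.+1}) i j :
  (forall x y, P x -> P y -> x - y \in W) -> unit_diff R i j \in W.
Proof.
move=> hW; have h := @base_unit_diff set0 i j; rewrite !inE /= in h.
have := hW _ _ (h isT) (base_in set0).
rewrite addrC addKr => /(memvZ 2); by rewrite scalerA mulfV ?scale1r // pnatr_eq0.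
Qed.

Lemma sum_unit_diff x : sumS setT x = 0 -> x = \sum_i x 0 i *: unit_diff R i ord0.
Proof.
move=> x0; under eq_bigr => i _ do rewrite /unit_diff scalerBr.
rewrite big_split /= sumrN -scaler_suml.
rewrite [X in X *: _](_ : _ = 0); last first.
  by rewrite -[RHS]x0 /sumS; apply: eq_bigl => i; rewrite inE.
by rewrite scale0r subr0 -row_sum_delta.
Qed.

Lemma direction_space_removahedron : is_direction_space P
  (lker (linfun (sumS setT : 'rV[R]_n.+1 -> R^o))).
Proof.
split=> [x y [_ hx] [_ hy]|W hW].
  by rewrite memv_ker lfunE /= sumSB hx hy subrr.
apply/subvP => x; rewrite memv_ker lfunE /= => /eqP /sum_unit_diff ->.
apply: memv_suml => i _; apply: memvZ; exact: unit_diff_direction.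
Qed.

Variable U : {vspace 'rV[R]_n.+1}.
Hypothesis hU : is_direction_space P U.

Lemma mem_direction x : (x \in U) = (sumS setT x == 0).
Proof.
apply/idP/eqP => [|/sum_unit_diff ->]; last first.
  by apply: memv_suml => i _; apply/memvZ/unit_diff_direction/hU.1.
have /subvP h := hU.2 _ direction_space_removahedron.1.
by move=> /h; rewrite memv_ker lfunE /= => /eqP.
Qed.

Lemma functional_eq (c d : 'Hom(subvs_of U, R^o)) :
  (forall i j, c (vsproj U (unit_diff R i j)) = d (vsproj U (unit_diff R i j))) -> c = d.
Proof.
move=> h; apply/lfunP => u.
have /eqP su : sumS setT (vsval u) == 0 by rewrite -mem_direction subvsP.
rewrite -[u]vsvalK (sum_unit_diff su) !linear_sum; apply: eq_bigr => i _.
by rewrite !linearZ /= h.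
Qed.

(** The sign makes the normal an outer one, since the constraint of [S] bounds [sumS S] from
    below. *)
Definition facet_normal S : dual_space U :=
  - linfun ((sumS S : 'rV[R]_n.+1 -> R^o) \o (vsval : subvs_of U -> _)).

Lemma facet_normalE S x : x \in U ->
  (facet_normal S : 'Hom(subvs_of U, R^o)) (vsproj U x) = - sumS S x.
Proof. by move=> xU; rewrite opp_lfunE lfunE /= vsprojK. Qed.

Lemma unit_diffN (i j : 'I_n.+1) : unit_diff R j i = - unit_diff R i j.
Proof. by rewrite /unit_diff opprB. Qed.

Lemma unit_diff_trans (i j k : 'I_n.+1) : unit_diff R i k = unit_diff R i j + unit_diff R j k.
Proof. by rewrite /unit_diff addrA subrK. Qed.

Definition facet S : set 'rV[R]_n.+1 :=
  [set x | P x /\ forall y, P y -> sumS S x <= sumS S y]%classic.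

Lemma facet_base S : S \in D -> facet S (base R S).
Proof.
move=> SD; split=> [|y [hy _]]; first exact: base_in.
by rewrite sumS_base_self; apply: hy.
Qed.

Lemma facet_is_face S : S \in D -> is_nonempty_face P (facet S).
Proof.
move=> SD; split; first by exists (base R S); apply: facet_base.
exists (- linfun (sumS S : 'rV[R]_n.+1 -> R^o)).
apply/seteqP; split=> x [Px h]; split=> // y /h; rewrite !opp_lfunE !lfunE /= lerN2 //.
Qed.

(** The displacements of [base_unit_diff] at [base R S] show that [c] vanishes on unit differences
    inside [S] or inside its complement, and hence takes a single nonpositive value on those from
    [S] to the complement. *)
Lemma normal_cone_facet S : S \in D -> S != set0 -> S != setT ->
  normal_cone (U := U) P (facet S) =
  [set c | exists2 a : R, 0 <= a & c = a *: facet_normal S]%classic.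
Proof.
move=> SD S0 ST; apply/seteqP; split=> c /=; last first.
  move=> [a a0 ->] x y [Px hx] Py; rewrite scale_lfunE facet_normalE; last exact: hU.1.
  by rewrite sumSB opprB; apply: mulr_ge0_le0 => //; rewrite subr_le0 hx.
move=> hc.
have neg i j : (i \in S) || (j \notin S) -> c (vsproj U (unit_diff R i j)) <= 0.
  move=> /base_unit_diff h; have := hc _ _ (facet_base SD) h.
  by rewrite addrC addKr !linearZ /= pmulr_rle0 ?invr_gt0.
have rN i j : c (vsproj U (unit_diff R j i)) = - c (vsproj U (unit_diff R i j)).
  by rewrite unit_diffN !linearN.
have cD u v : c (vsproj U (u + v)) = c (vsproj U u) + c (vsproj U v).
  by rewrite !linearD.
have zero i j : (i \in S) = (j \in S) -> c (vsproj U (unit_diff R i j)) = 0.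
  move=> e; apply/eqP; rewrite eq_le neg ?e ?orbN //=.
  by rewrite -oppr_le0 -rN neg // e orbN.
have [i0 iS] := set0Pn _ S0.
have [j0 jS] : exists j, j \notin S.
  apply/existsP; rewrite -negb_forall; apply: contra ST => /forallP h.
  by apply/eqP/setP => k; rewrite h inE.
exists (- c (vsproj U (unit_diff R i0 j0))); first by rewrite oppr_ge0 neg ?iS.
have up i j : i \in S -> j \notin S ->
    c (vsproj U (unit_diff R i j)) = c (vsproj U (unit_diff R i0 j0)).
  move=> hi hj; rewrite (unit_diff_trans i i0 j) (cD (unit_diff R i i0)).
  rewrite (unit_diff_trans i0 j0 j) (cD (unit_diff R i0 j0)).
  by rewrite (zero i i0) ?hi // (zero j0 j) ?(negPf hj) ?(negPf jS) // add0r addr0.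
apply: functional_eq => i j; rewrite scale_lfunE facet_normalE; last first.
  exact/unit_diff_direction/hU.1.
rewrite sumS_unit_diff; have [hi|hi] := boolP (i \in S); have [hj|hj] := boolP (j \in S).
- by rewrite (zero i j) ?hi ?hj // subrr oppr0 scaler0.
- rewrite (up i j) // subr0 scalerN scaleNr opprK; exact/esym/(mulr1 (_ : R)).
- rewrite (rN j i) (up j i) // sub0r opprK; exact/esym/(mulr1 (_ : R)).
by rewrite (zero i j) ?(negPf hi) ?(negPf hj) // subrr oppr0 scaler0.
Qed.

(** Faces are convex: the midpoint of the point found for the tail and of a point of [F] off the
    facet of [S] keeps half of either slack. *)
Lemma interior_point (F : set 'rV[R]_n.+1) (l : seq {set 'I_n.+1}) :
  is_nonempty_face P F -> {subset l <= D} ->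
  (forall S, S \in l -> exists2 x, F x & triangle R #|S| < sumS S x) ->
  exists2 x, F x & exists2 e : R, 0 < e &
    forall S, S \in l -> triangle R #|S| + e <= sumS S x.
Proof.
move=> [[x0 Fx0] [phi Fphi]].
elim: l => [|S l IH] lD h; first by exists x0 => //; exists 1.
have [T Tl|T Tl|x Fx [e e0 hx]] := IH; first by apply: lD; rewrite inE Tl orbT.
  by apply: h; rewrite inE Tl orbT.
have [x' Fx' hx'] := h S (mem_head _ _).
exists (2^-1 *: (x + x')).
  move: Fx Fx'; rewrite Fphi => -[Px mx] [Px' mx'].
  have Pm : P (2^-1 *: (x + x')).
    split=> [T TD|].
      rewrite sumSZ sumSD; have := Px.1 T TD; have := Px'.1 T TD; lra.
    by rewrite sumSZ sumSD Px.2 Px'.2; field.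
  split=> // y Py; have := mx y Py; have := mx' y Py.
  have -> : (phi (2^-1 *: (x + x')) : R) = 2^-1 * ((phi x : R) + (phi x' : R)).
    by rewrite linearZ linearD.
  by lra.
have PF y : F y -> P y by rewrite Fphi => -[].
pose d := sumS S x' - triangle R #|S|.
exists (Num.min e d / 2); first by rewrite divr_gt0 // lt_min e0 subr_gt0.
have m1 : Num.min e d <= e by rewrite ge_min lexx.
have m2 : Num.min e d <= d by rewrite ge_min lexx orbT.
move=> T; rewrite inE => /orP [/eqP ->|Tl]; rewrite sumSZ sumSD.
  have := (PF _ Fx).1 S (lD _ (mem_head _ _)); move: m2; rewrite /d; lra.
have := hx T Tl; have := (PF _ Fx').1 T; rewrite lD ?inE ?Tl ?orbT // => /(_ isT).
lra.
Qed.

(* Otherwise [F] would contain a point in the relative interior of the polytope. *)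
Lemma facet_normal_in_cone (F : set 'rV[R]_n.+1) (c : dual_space U) :
  is_nonempty_face P F -> normal_cone P F c -> c != 0 ->
  exists S, [/\ S \in D, S != set0, S != setT & normal_cone P F (facet_normal S)].
Proof.
move=> hF hc c0; apply: contrapT => nex.
have [x0 Fx0] := hF.1; have [phi Fphi] := hF.2.
have PF y : F y -> P y by rewrite Fphi => -[].
pose l := [seq S <- enum {set 'I_n.+1} | [&& S \in D, S != set0 & S != setT]].
have [||x Fx [e e0 hx]] := @interior_point F l hF.
- by move=> S; rewrite mem_filter => /andP [/and3P []].
- move=> S; rewrite mem_filter => /andP [/and3P [SD S0 ST] _].
  apply: contrapT => nS; apply: nex; exists S; split=> // x y Fx Py.
  rewrite facet_normalE; last by apply: hU.1 => //; exact: PF.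
  rewrite sumSB opprB subr_le0.
  apply: le_trans (Py.1 S SD); rewrite leNgt; apply/negP => h; apply: nS; by exists x.
(* The room [e] in every direction makes [c] nonpositive on each unit difference and on its
   opposite, hence zero. *)
have neg i j : (c : 'Hom(subvs_of U, R^o)) (vsproj U (unit_diff R i j)) <= 0 :> R.
  suff Py : P (x + e *: unit_diff R i j).
    by have := hc _ _ Fx Py; rewrite addrC addKr !linearZ /= pmulr_rle0.
  split=> [S SD|]; rewrite sumSD sumSZ sumS_unit_diff; last first.
    by rewrite !in_setT subrr mulr0 addr0; apply: (PF _ Fx).2.
  have [->|S0] := eqVneq S set0.
    by rewrite !in_set0 subrr mulr0 addr0 /sumS big_set0 /triangle cards0 mul0n mul0r.
  have [->|ST] := eqVneq S setT.
    by rewrite !in_setT subrr mulr0 addr0 (PF _ Fx).2 cardsT card_ord.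
  have := hx S; rewrite mem_filter SD S0 ST mem_enum => /(_ isT).
  case: (i \in S) (j \in S) => [] [] /=; lra.
move/eqP: c0; apply; apply: functional_eq => i j; rewrite zero_lfunE.
apply/eqP; rewrite eq_le neg /= -oppr_le0 -[- _](linearN (c : 'Hom(subvs_of U, R^o))).
by rewrite -linearN -unit_diffN neg.
Qed.

End Geometry.

(** * Reflection and reversal *)

Section AffineInvolution.
Variables (R : realType) (n : nat) (D1 D2 : {pred {set 'I_n.+1}}).
Variables (L : 'End('rV[R]_n.+1)) (c : 'rV[R]_n.+1).
Hypotheses (LL : forall x, L (L x) = x) (Lc : L c + c = 0).
Hypothesis D12 : forall x, removahedron D2 x <-> removahedron D1 (L x + c).

Lemma affine_involutive x : L (L x + c) + c = x.
Proof. by rewrite linearD /= LL -addrA Lc addr0. Qed.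

(** Both direction spaces are the same kernel, preserved by [L]. Composing functionals with [L]
    carries the normal cone of a face [F] to that of the preimage of [F] under [x |-> L x + c], and
    it is its own inverse. *)
Lemma affine_involution_normally_isomorphic :
  normally_isomorphic (@removahedron R n D1) (@removahedron R n D2).
Proof.
have hU1 := @direction_space_removahedron R n D1.
have hU2 := @direction_space_removahedron R n D2.
set U := lker _ in hU1 hU2; exists U, U; split => //.
have D21 x : removahedron D1 x -> removahedron D2 (L x + c).
  by move=> h; apply/D12; rewrite affine_involutive.
have LU x : x \in U -> L x \in U.
  suff /subvP h : (U <= L @^-1: U)%VS by move=> /h; rewrite memv_preim.
  apply: hU1.2 => x' y hx hy; rewrite -memv_preim.
  have := hU2.1 _ _ (D21 _ hx) (D21 _ hy).
  by rewrite opprD addrACA subrr addr0 -linearB.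
pose M : 'End(subvs_of U) := linfun (vsproj U \o L \o vsval).
have ME x : x \in U -> M (vsproj U x) = vsproj U (L x).
  by move=> xU; rewrite lfunE /= vsprojK.
have MM u : M (M u) = u.
  have xU := subvsP u; rewrite -[u]vsvalK; move: (vsval u) xU => x xU.
  by rewrite !ME ?LL // LU.
pose f0 (d : dual_space U) : dual_space U := ((d : 'Hom(subvs_of U, R^o)) \o M)%VF.
have f0_lin : linear f0 by move=> a d e; rewrite /f0 comp_lfunDl comp_lfunZl.
pose fL := HB.pack_for {linear dual_space U -> dual_space U} f0
  (GRing.isLinear.Build R (dual_space U) (dual_space U) _ f0 f0_lin).
pose f : 'Hom(dual_space U, dual_space U) := linfun fL.
have fE d u : (f d : 'Hom(subvs_of U, R^o)) u = (d : 'Hom(subvs_of U, R^o)) (M u).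
  by rewrite lfunE /= comp_lfunE.
have ff d : f (f d) = d by apply/lfunP => u; rewrite !fE MM.
exists f; first by exists f.
have cone F (FP : forall x, F x -> removahedron D1 x) : (f @` normal_cone (U := U) (removahedron D1) F =
    normal_cone (U := U) (removahedron D2) [set x | F (L x + c)])%classic.
  have L2 x y : L (y - x) = (L y + c) - (L x + c).
    by rewrite opprD addrACA subrr addr0 linearB.
  apply/seteqP; split=> [_ [d hd <-] x y Fx Py|d hd] /=.
    rewrite fE ME; last by apply: hU2.1 => //; apply/D12; exact: FP.
    by rewrite L2; apply: hd => //; exact/D12.
  exists (f d); last exact: ff.
  move=> x y Fx Py /=; rewrite fE ME; last by apply: hU1.1 => //; exact: FP.
  rewrite L2; apply: hd; last exact: D21.
  by rewrite /= affine_involutive.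
move=> _ [F [[x0 Fx0] [phi Fphi]] ->].
have FP x : F x -> removahedron D1 x by rewrite Fphi => -[].
exists [set x | F (L x + c)]%classic; last exact: cone.
split; first by exists (L x0 + c) => /=; rewrite affine_involutive.
exists (phi \o L)%VF; apply/seteqP; split=> x /=; rewrite Fphi => -[hx hm].
  split=> [|y /D12 hy]; first exact/D12.
  by have := hm _ hy; rewrite !comp_lfunE !linearD lerD2r.
split=> [|y hy]; first exact/D12.
have := hm _ (D21 _ hy); rewrite !comp_lfunE -(lerD2r (phi c)).
by rewrite -!(linearD phi) affine_involutive.
Qed.
End AffineInvolution.

Section Symmetries.
Variable n : nat.
Implicit Types (s : n.-1.-tuple bool) (S : {set 'I_n.+1}).

(** At the two end positions one of the constancy conditions is void. Only positions with an actual
    entry of [s] remain, where [map] and [rev] can be followed without default values. *)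
Lemma fam_interiorP s S : reflect (forall k : 'I_n.+1, (0 < k)%N -> (k < n)%N ->
  [\/ (k \in S) = ~~ nth true s k.-1,
    forall a : 'I_n.+1, (a <= k)%N -> (a \in S) = (k \in S) |
    forall a : 'I_n.+1, (k <= a)%N -> (a \in S) = (k \in S)]) (S \in fam s).
Proof.
apply: (iffP (famP s S)) => h k; first by move=> _ _; exact: h.
have [k0|k0] := posnP k.
  constructor 2 => a; rewrite k0 leqn0 => /eqP a0.
  by have -> : a = k by apply: val_inj; rewrite /= a0 k0.
have [kn|kn] := leqP n k; last exact: h.
constructor 3 => a ka; have -> // : a = k; apply/val_inj/eqP.
by rewrite eqn_leq ka (leq_trans _ kn) // -ltnS ltn_ord.
Qed.

Lemma fam_setC s S : S \in fam s -> ~: S \in fam (reflection s).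
Proof.
move=> /fam_interiorP h; apply/fam_interiorP => k k0 kn.
case: (h k k0 kn) => e; [constructor 1|constructor 2|constructor 3].
- rewrite inE e (nth_map true) ?negbK // size_tuple; lia.
- by move=> a ak; rewrite !inE e.
- by move=> a ak; rewrite !inE e.
Qed.

Lemma fam_rev s S : S \in fam s -> [set k | rev_ord k \in S] \in fam (reversal s).
Proof.
move=> /fam_interiorP h; apply/fam_interiorP => k k0 kn.
have r0 : (0 < rev_ord k)%N by rewrite /= subSS subn_gt0.
have rn : (rev_ord k < n)%N by rewrite /= subSS; lia.
case: (h _ r0 rn) => e; [constructor 1|constructor 3|constructor 2].
- rewrite inE e nth_rev ?size_tuple; last by lia.
  by congr (~~ nth true s _); rewrite /= subSS; lia.
- by move=> a ak; rewrite !inE e //= leq_sub2l.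
- by move=> a ak; rewrite !inE e //= leq_sub2l.
Qed.

Lemma reflectionK s : reflection (reflection s) = s.
Proof. by apply: val_inj; rewrite /= mapK //; exact: negbK. Qed.

Lemma reversalK s : reversal (reversal s) = s.
Proof. by apply: val_inj; rewrite /= revK. Qed.

Lemma reversal_reflection s : reversal (reflection s) = reflection (reversal s).
Proof. by apply: val_inj; rewrite /= map_rev. Qed.

(** The two operations are commuting involutions. *)
Lemma obtained_fromP s t : obtained_from s t ->
  [\/ t = s, t = reflection s, t = reversal s | t = reflection (reversal s)].
Proof.
elim=> {t} [|t _|t _]; first by constructor 1.
  case=> ->; rewrite ?reflectionK; by [constructor 2|constructor 1|constructor 4|constructor 3].
case=> ->; rewrite ?reversal_reflection ?reversalK;
  by [constructor 3|constructor 4|constructor 1|constructor 2].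
Qed.

Variable R : realType.
Implicit Types x : 'rV[R]_n.+1.

Definition rev_row x : 'rV[R]_n.+1 := \row_k x 0 (rev_ord k).

Lemma rev_rowK : involutive rev_row.
Proof. by move=> x; apply/rowP => k; rewrite !mxE rev_ordK. Qed.

Fact rev_row_linear : linear rev_row.
Proof. by move=> a x y; apply/rowP => k; rewrite !mxE. Qed.
HB.instance Definition _ :=
  GRing.isLinear.Build R 'rV[R]_n.+1 'rV[R]_n.+1 _ rev_row rev_row_linear.

Lemma sumS_rev S x : sumS S (rev_row x) = sumS [set k | rev_ord k \in S] x.
Proof.
rewrite /sumS (reindex_inj rev_ord_inj) /=.
by apply: eq_big => k; rewrite ?inE // mxE rev_ordK.
Qed.

Lemma card_rev S : #|[set k | rev_ord k \in S]| = #|S|.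
Proof.
have -> : [set k | rev_ord k \in S] = @rev_ord n.+1 @: S.
  apply/setP => k; rewrite inE; apply/idP/imsetP => [h|[l lS ->]].
    by exists (rev_ord k); rewrite ?rev_ordK.
  by rewrite rev_ordK.
by rewrite card_imset //; exact: rev_ord_inj.
Qed.

Lemma removahedron_reversal s x :
  removahedron (fam (reversal s)) x <-> removahedron (fam s) (rev_row x).
Proof.
have imp t y : removahedron (fam (reversal t)) y -> removahedron (fam t) (rev_row y).
  case=> h e; split=> [S hS|].
    by rewrite sumS_rev -card_rev; apply/h/fam_rev.
  by rewrite sumS_rev -e; congr sumS; apply/setP => k; rewrite !inE.
by split=> [/imp //|h]; rewrite -[x]rev_rowK; apply: imp; rewrite reversalK.
Qed.

Definition twice_center : 'rV[R]_n.+1 := const_mx n.+2%:R.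

Lemma sumS_twice_center S x : sumS S (twice_center - x) = (n.+2 * #|S|)%:R - sumS S x.
Proof.
rewrite sumSB; congr (_ - _); rewrite /sumS.
under eq_bigr => i _ do rewrite mxE.
by rewrite sumr_const natrM mulr_natr.
Qed.

(** The constraint of [S] at the reflected point is that of the complement at [x]: if
    [a + b = n + 1], then [(n + 2) a + T(b) = T(n + 1) + T(a)] for the triangular numbers [T]. *)
Lemma removahedron_reflection s x :
  removahedron (fam (reflection s)) x <-> removahedron (fam s) (twice_center - x).
Proof.
have total : (n.+2 * n.+1)%:R = 2 * triangle R n.+1.
  by rewrite /triangle addn1 mulnC mulrC divfK // pnatr_eq0.
have imp t y : removahedron (fam (reflection t)) y -> removahedron (fam t) (twice_center - y).
  case=> h e; split=> [S hS|]; rewrite sumS_twice_center; last first.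
    by rewrite e cardsT card_ord total; ring.
  have := h _ (fam_setC hS).
  have <- : sumS setT y - sumS S y = sumS (~: S) y.
    rewrite /sumS (big_setID S) /= setTI setTD; ring.
  rewrite e; have := cardsC S; rewrite card_ord.
  move: (sumS S y) #|S| #|~: S| => r a b ab; rewrite /triangle -ab.
  rewrite -[(a + b).+1]addn1 !natrM !natrD; lra.
by split=> [/imp //|h]; rewrite -[x](subKr twice_center); apply: imp; rewrite reflectionK.
Qed.

Lemma obtained_normally_isomorphic s t : obtained_from s t ->
  normally_isomorphic (@removahedron R n (fam s)) (@removahedron R n (fam t)).
Proof.
pose rho : 'End('rV[R]_n.+1) := linfun rev_row.
have rhoE x : rho x = rev_row x by rewrite lfunE.
have rho_c : rho twice_center = twice_center by rewrite rhoE; apply/rowP => k; rewrite !mxE.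
have idN x : (- \1 : 'End('rV[R]_n.+1))%VF x = - x by rewrite opp_lfunE id_lfunE.
have rN x : (- rho) x = - rev_row x by rewrite opp_lfunE rhoE.
have rVN x : rev_row (- x) = - rev_row x by rewrite linearN.
case/obtained_fromP => ->.
- apply: (@affine_involution_normally_isomorphic _ _ _ _ \1%VF 0) => [x||x].
  + by rewrite !id_lfunE.
  + by rewrite linear0 addr0.
  + by rewrite id_lfunE addr0.
- apply: (@affine_involution_normally_isomorphic _ _ _ _ (- \1)%VF twice_center) => [x||x].
  + by rewrite !idN opprK.
  + by rewrite idN addNr.
  + by rewrite idN addrC; exact: removahedron_reflection.
- apply: (@affine_involution_normally_isomorphic _ _ _ _ rho 0) => [x||x].
  + by rewrite !rhoE rev_rowK.
  + by rewrite linear0 addr0.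
  + by rewrite rhoE addr0; exact: removahedron_reversal.
apply: (@affine_involution_normally_isomorphic _ _ _ _ (- rho) twice_center) => [x||x].
- by rewrite !rN rVN opprK rev_rowK.
- by rewrite rN -rhoE rho_c addNr.
rewrite rN addrC; apply: (iff_trans (removahedron_reflection _ _)).
apply: (iff_trans (removahedron_reversal _ _)).
by rewrite linearB /= -rhoE rho_c.
Qed.

End Symmetries.

(** * Changes of a word *)

Section Words.
Variable n : nat.
Implicit Types (s : n.-1.-tuple bool) (S T : {set 'I_n.+1}) (m p q : 'I_n).

(** Positions are natural numbers so that successors can be taken freely; the value is meaningful
    for [k <= n]. *)
Definition letter S (k : nat) : bool := inord k \in S.
Definition change S (k : nat) : bool := letter S k != letter S k.+1.

Lemma in_at S (k : 'I_n.+1) : (k \in S) = letter S k.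
Proof. by rewrite /letter inord_val. Qed.

Lemma at_set (w : nat -> bool) (k : nat) : (k <= n)%N ->
  letter [set i : 'I_n.+1 | w i] k = w k.
Proof. by move=> kn; rewrite /letter inE inordK. Qed.

Lemma fam_at s S (k : nat) : S \in fam s -> (0 < k)%N -> (k < n)%N ->
  [\/ letter S k = ~~ nth true s k.-1,
    forall a, (a <= k)%N -> letter S a = letter S k |
    forall a, (k <= a <= n)%N -> letter S a = letter S k].
Proof.
move=> /fam_interiorP h k0 kn; have kn' : (k < n.+1)%N by rewrite ltnW.
have := h (Ordinal kn') k0 kn; rewrite in_at /= => -[e|e|e]; [constructor 1|constructor 2|constructor 3] => //.
  move=> a ak; have an : (a < n.+1)%N by apply: leq_ltn_trans kn'.
  by rewrite -(e (Ordinal an)) // in_at.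
move=> a /andP [ka an]; by rewrite -(e (Ordinal (an : (a < n.+1)%N))) // in_at.
Qed.

Lemma at_const S (a b : nat) : (a <= b)%N ->
  (forall k, (a <= k < b)%N -> ~~ change S k) -> letter S a = letter S b.
Proof.
elim: b => [|b IH]; first by rewrite leqn0 => /eqP ->.
rewrite leq_eqVlt => /orP [/eqP -> //|]; rewrite ltnS => ab h.
have := h b; rewrite ab ltnSn => /(_ isT); rewrite negbK => /eqP <-.
by apply: IH => // k /andP [ak kb]; apply: h; rewrite ak ltnW.
Qed.

(** The change at [p] excludes a constant prefix ending at [k], and the change at [q] a constant
    suffix starting there. *)
Lemma fam_between s S (p q : nat) (k : nat) : S \in fam s -> change S p -> change S q ->
  (q < n)%N -> (p < k <= q)%N -> letter S k = ~~ nth true s k.-1.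
Proof.
move=> hS hp hq qn /andP [pk kq].
case: (fam_at hS (leq_ltn_trans (leq0n p) pk) (leq_ltn_trans kq qn)) => // e.
  by move: hp; rewrite /change !e ?eqxx // ltnW.
by move: hq; rewrite /change !e ?eqxx //; lia.
Qed.

Lemma nontrivialP S : reflect (exists m, change S m) ((S != set0) && (S != setT)).
Proof.
apply: (iffP idP) => [/andP [S0 ST]|[m]]; last first.
  rewrite /change /letter => h; apply/andP; split; apply: contra h => /eqP ->.
    by rewrite !in_set0.
  by rewrite !in_setT.
apply/existsP; apply: contraT => /existsPn h.
have c (k : 'I_n.+1) : (k \in S) = letter S 0.
  rewrite in_at; apply/esym/at_const => // l /andP [_ lk].
  have ln : (l < n)%N by have := ltn_ord k; lia.
  exact: (h (Ordinal ln)).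
case: (letter S 0) c => c.
  by case/eqP: ST; apply/setP => k; rewrite c inE.
by case/eqP: S0; apply/setP => k; rewrite c inE.
Qed.

Definition is_lower s (k : nat) := ~~ nth true s k.-1.

(** For [p < q] the two constant ends are opposite to the adjoining letters, so that the first
    change is at [p] and the last one at [q]. *)
Definition zigzag s (p q : nat) : {set 'I_n.+1} := [set k : 'I_n.+1 |
  if (k <= p)%N then ~~ is_lower s p.+1 else if (k <= q)%N then is_lower s k
  else ~~ is_lower s q].

Lemma at_zigzag s (p q k : nat) : (k <= n)%N -> letter (zigzag s p q) k =
  if (k <= p)%N then ~~ is_lower s p.+1 else if (k <= q)%N then is_lower s k
  else ~~ is_lower s q.
Proof. exact: (@at_set (fun k => if (k <= p)%N then _ else if (k <= q)%N then is_lower s k else _)). Qed.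

Lemma zigzag_fam s p q : (p < q)%N -> zigzag s p q \in fam s.
Proof.
move=> pq; apply/fam_interiorP => k k0 kn.
have [kp|pk] := leqP k p.
  by constructor 2 => a ak; rewrite !inE kp (leq_trans ak kp).
have [kq|qk] := leqP k q; first by constructor 1; rewrite inE leqNgt pk /= kq.
by constructor 3 => a ka; rewrite !inE !(leqNgt _ p) !(leqNgt _ q) pk qk
  (leq_trans pk ka) (leq_trans qk ka).
Qed.

Lemma change_zigzagl s p q : (p < q)%N -> change (zigzag s p q) p.
Proof.
move=> pq; rewrite /change (at_zigzag _ _ _ (ltnW (ltn_ord p))).
rewrite (at_zigzag _ _ _ (ltn_ord p)) leqnn ltnn pq.
by case: is_lower.
Qed.

Lemma change_zigzagr s p q : (p < q)%N -> change (zigzag s p q) q.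
Proof.
move=> pq; rewrite /change (at_zigzag _ _ _ (ltnW (ltn_ord q))).
rewrite (at_zigzag _ _ _ (ltn_ord q)) leqnn ltnn (ltn_geF pq) (ltnNge q p) (ltnW pq) /=.
by case: is_lower.
Qed.

Lemma change_zigzag_out s p q m : (p < q)%N -> change (zigzag s p q) m -> (p <= m <= q)%N.
Proof.
move=> pq; apply: contraTT; rewrite negb_and -!ltnNge negbK.
rewrite (at_zigzag _ _ _ (ltnW (ltn_ord m))) (at_zigzag _ _ _ (ltn_ord m)).
move=> /orP [mp|qm]; first by rewrite mp (ltnW mp).
have pm := ltn_trans pq qm.
by rewrite (ltn_geF pm) (ltn_geF qm) (ltnNge m p) (ltnNge m q) (ltnW pm) (ltnW qm) /= negbK.
Qed.

Lemma zigzag_inj s p q p' q' : (p < q)%N -> (p' < q')%N ->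
  (forall m, change (zigzag s p q) m = change (zigzag s p' q') m) -> p = p' /\ q = q'.
Proof.
move=> pq pq' h.
have := change_zigzag_out pq (etrans (h p') (change_zigzagl s pq')).
have := change_zigzag_out pq (etrans (h q') (change_zigzagr s pq')).
have := change_zigzag_out pq' (etrans (esym (h p)) (change_zigzagl s pq)).
have := change_zigzag_out pq' (etrans (esym (h q)) (change_zigzagr s pq)).
by move=> *; split; apply: val_inj => /=; lia.
Qed.

Definition initial (t : nat) : {set 'I_n.+1} := [set k : 'I_n.+1 | (k <= t)%N].

Lemma at_initial (t k : nat) : (k <= n)%N -> letter (initial t) k = (k <= t)%N.
Proof. exact: (@at_set (fun k => k <= t)%N). Qed.

Lemma initial_fam s m : initial m \in fam s.
Proof.
apply/famP => k; have [km|mk] := leqP k m.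
  by constructor 2 => a ak; rewrite !inE km (leq_trans ak).
by constructor 3 => a ak; rewrite !inE (ltn_geF mk) (ltn_geF (leq_trans mk ak)).
Qed.

Lemma initialC_fam s m : ~: initial m \in fam s.
Proof.
apply/famP => k; have [km|mk] := leqP k m.
  by constructor 2 => a ak; rewrite !inE km (leq_trans ak).
by constructor 3 => a ak; rewrite !inE (ltn_geF mk) (ltn_geF (leq_trans mk ak)).
Qed.

End Words.

Section Boundary.
Variables (R : realType) (n : nat).
Implicit Types (s : n.-1.-tuple bool) (S T : {set 'I_n.+1}) (m p q : 'I_n).

(** The coordinates of the ray of [S] in the basis formed by the rays of the initial segments. *)
Definition boundary S : 'rV[R]_n := \row_m ((letter S m)%:R - (letter S m.+1)%:R).
Local Notation b := boundary.
Local Notation d m := (delta_mx 0 m : 'rV[R]_n).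

Lemma boundaryE S m : b S 0 m = (letter S m)%:R - (letter S m.+1)%:R.
Proof. by rewrite mxE. Qed.

Lemma boundary_neq0 S m : (b S 0 m != 0) = change S m.
Proof.
by rewrite boundaryE /change subr_eq0 (eqr_nat R); case: (letter _ _) (letter _ _) => [] [].
Qed.

Lemma boundary_norm S m : change S m -> `|b S 0 m| = 1.
Proof.
rewrite boundaryE /change; case: (letter _ _) (letter _ _) => [] [] //= _;
  by rewrite ?sub0r ?subr0 ?normrN normr1.
Qed.

Lemma sum_boundary S : \sum_m b S 0 m = (letter S 0)%:R - (letter S n)%:R.
Proof.
under eq_bigr => m _ do rewrite boundaryE.
rewrite -(big_mkord xpredT (fun m : nat => (letter S m)%:R - (letter S m.+1)%:R)).
rewrite -[LHS]opprK -sumrN; under eq_bigr => m _ do rewrite opprB.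
by rewrite telescope_sumr // opprB.
Qed.

Lemma boundary_initial m : b (initial n m) = d m.
Proof.
apply/rowP => k; rewrite !mxE (at_initial _ (ltnW (ltn_ord k))) (at_initial _ (ltn_ord k)).
rewrite eqxx /= -val_eqE /=.
by case: (ltngtP k m); rewrite ?subrr ?subr0.
Qed.

Lemma boundary_setC S : b (~: S) = - b S.
Proof.
apply/rowP => k; rewrite !mxE /letter !inE.
by case: (_ \in S) (_ \in S) => [] [] /=; ring.
Qed.

(** Between the extreme changes the letters are forced by [fam_between]. At [p] and at [q] one of
    the two letters is forced, and the other follows because both words change there. *)
Lemma boundary_zigzag s S p q : S \in fam s -> (p < q)%N -> change S p -> change S q ->
  (forall m, change S m -> (p <= m <= q)%N) -> b S = b (zigzag s p q).
Proof.
move=> hS pq hp hq hout; have hz := zigzag_fam s pq.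
have zp := change_zigzagl s pq; have zq := change_zigzagr s pq.
have e k : (p < k <= q)%N -> letter S k = letter (zigzag s p q) k.
  by move=> hk; rewrite (fam_between hS hp hq _ hk) // (fam_between hz zp zq _ hk).
have e' k : change S k -> change (zigzag s p q) k -> letter S k = letter (zigzag s p q) k <->
    letter S k.+1 = letter (zigzag s p q) k.+1.
  by rewrite /change; case: (letter _ _) (letter _ _) (letter _ _) (letter _ _) => [] [] [] [].
apply/rowP => m; have [hm|hm] := boolP (p <= m <= q)%N; last first.
  have /eqP -> : b S 0 m == 0.
    by rewrite -[_ == _]negbK boundary_neq0; apply: contra hm => /hout.
  apply/esym/eqP; rewrite -[_ == _]negbK boundary_neq0; apply: contra hm.
  exact: change_zigzag_out.
have [mp|pm] := eqVneq m p.
  rewrite !boundaryE mp; have h := e p.+1; rewrite ltnSn pq in h.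
  by rewrite (e' p hp zp).2 h.
have [mq|qm] := eqVneq m q.
  rewrite !boundaryE mq; have h := e q; rewrite leqnn pq in h.
  by rewrite (e' q hq zq).1 h.
rewrite !boundaryE !e //; move: pm qm; rewrite -!val_eqE /=; lia.
Qed.

End Boundary.

(** * The order defined by the signs *)

Section Precedence.
Variables (R : realType) (n : nat).
Implicit Types (s : n.-1.-tuple bool) (S T : {set 'I_n.+1}) (m p q r : 'I_n).
Local Notation b := (boundary R).
Local Notation d m := (delta_mx 0 m : 'rV[R]_n).

Lemma delta_entry p q : (d p) 0 q = (q == p)%:R.
Proof. by rewrite mxE eqxx. Qed.

(** The entries sum to a difference of two letters, whereas two nonzero entries of the same sign
    would sum to 2 or -2. *)
Lemma two_changes S p q : p != q -> change S p -> change S q ->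
  (forall m, m != p -> m != q -> ~~ change S m) -> b S 0 q = - b S 0 p.
Proof.
move=> pq hp hq hm; have := sum_boundary R S.
rewrite (bigD1 p) // (bigD1 q) 1?eq_sym //= big1 ?addr0; last first.
  move=> m /andP [mp mq]; apply/eqP; rewrite -[_ == _]negbK boundary_neq0; exact: hm.
move: hp hq; rewrite !boundaryE /change.
case: (letter S 0) => /=; case: (letter S n) => /=; case: (letter S p) => /=; case: (letter S q) => /=;
case: (letter S p.+1) => //=; case: (letter S q.+1) => //= _ _; lra.
Qed.

Definition precedes s p q : Prop := exists2 S, S \in fam s & b S = d q - d p.

(** With changes only at [p] and [q], the letters from [p.+1] to [q] are constant and given by
    [is_lower]; their common value is read off from the sign of the entry at [p]. The boolean [t]
    treats both orientations at once. *)
Lemma precedesP s p q (t : bool) : (p < q)%N ->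
  (if t then precedes s p q else precedes s q p) <->
  forall k, (p < k <= q)%N -> is_lower s k = t.
Proof.
move=> pq; have npq : p != q by rewrite -val_eqE /= ltn_eqF.
have ext : (if t then precedes s p q else precedes s q p) <->
    exists2 S, S \in fam s & b S = (-1) ^+ t.+1 *: (d q - d p).
  case: t; rewrite /precedes /=; split=> -[S hS e]; exists S => //; rewrite e.
  - by rewrite -signr_odd scale1r.
  - by rewrite -signr_odd scale1r.
  - by rewrite expr1 scaleN1r opprB.
  - by rewrite expr1 scaleN1r opprB.
apply: (iff_trans ext); split=> [[S hS e] k /andP [pk kq]|h].
  have ent m : b S 0 m = (-1) ^+ t.+1 * ((m == q)%:R - (m == p)%:R).
    by rewrite e !mxE !eqxx.
  have hp : change S p by rewrite -(boundary_neq0 R) ent (negPf npq) eqxx mulf_neq0 ?signr_eq0 // sub0r oppr_eq0 oner_eq0.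
  have hq : change S q by rewrite -(boundary_neq0 R) ent (eq_sym q p) (negPf npq) eqxx mulf_neq0 ?signr_eq0 // subr0 oner_eq0.
  rewrite /is_lower -(fam_between hS hp hq (ltn_ord q)) ?pk //.
  rewrite -(@at_const _ S p.+1 k) //; last first.
    move=> l /andP [pl lk]; have ln : (l < n)%N by have := ltn_ord q; lia.
    rewrite -(boundary_neq0 R S (Ordinal ln)) ent -!val_eqE /= negbK.
    by rewrite (ltn_eqF (leq_trans lk kq)) (gtn_eqF pl) subrr mulr0.
  have := ent p; rewrite boundaryE (negPf npq) eqxx.
  case: (t) => /=; case: (letter S p) => /=; case: (letter S p.+1) => //=; lra.
exists (zigzag s p q); first exact: zigzag_fam.
have az k : (k <= n)%N -> letter (zigzag s p q) k = if (p < k <= q)%N then t else ~~ t.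
  move=> kn; rewrite at_zigzag //; case: ltnP => pk /=; last by rewrite h ?ltnSn.
  by case: ltnP => kq; rewrite h ?pk ?kq // pq leqnn.
apply/rowP => m; rewrite boundaryE !mxE !eqxx /=.
rewrite (az _ (ltnW (ltn_ord m))) (az _ (ltn_ord m)) -!val_eqE /= ltnS.
case: (ltngtP m p) => h1; case: (ltngtP m q) => h2 /=;
  try (by exfalso; lia); case: (t) => /=; rewrite ?expr2 ?expr1; lra.
Qed.

(** The condition of [precedesP] passes to subintervals, so the position just after the smaller of
    the two indices lies between them in the order. *)
Lemma precedes_chain s p q : precedes s p q -> (p.+1 < q)%N \/ (q.+1 < p)%N ->
  exists r, [/\ r != p, r != q, precedes s p r & precedes s r q].
Proof.
move=> pq [lt|lt].
  have rn : (p.+1 < n)%N by apply: ltn_trans lt (ltn_ord q).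
  have h := (precedesP s true (ltn_trans (ltnSn _) lt)).1 pq.
  exists (Ordinal rn); rewrite -!val_eqE /= (gtn_eqF (ltnSn p)) (ltn_eqF lt); split=> //.
    by apply: (precedesP s true _).2 => //= k hk; apply: h; lia.
  by apply: (precedesP s true _).2 => //= k hk; apply: h; lia.
have rn : (q.+1 < n)%N by apply: ltn_trans lt (ltn_ord p).
have h := (precedesP s false (ltn_trans (ltnSn _) lt)).1 pq.
exists (Ordinal rn); rewrite -!val_eqE /= (gtn_eqF (ltnSn q)) (ltn_eqF lt); split=> //.
  by apply: (precedesP s false _).2 => //= k hk; apply: h; lia.
by apply: (precedesP s false _).2 => //= k hk; apply: h; lia.
Qed.

(** Here [r] is on the same side of both positions, and [precedesP] prescribes opposite values of
    [is_lower] at one position: [r.+1] if [r] is to the left, [r] otherwise. *)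
Lemma precedes_cover s p q r : q = p.+1 :> nat \/ p = q.+1 :> nat ->
  r != p -> r != q -> precedes s p r -> precedes s r q -> False.
Proof.
rewrite -!val_eqE /= => pq rp rq h1 h2.
have [lt|lt] : (r < p)%N /\ (r < q)%N \/ (p < r)%N /\ (q < r)%N by lia.
  have := (precedesP s false lt.1).1 h1 r.+1; have := (precedesP s true lt.2).1 h2 r.+1.
  by rewrite ltnSn lt.1 lt.2 /= => -> // /(_ isT).
have := (precedesP s true lt.1).1 h1 r; have := (precedesP s false lt.2).1 h2 r.
by rewrite leqnn lt.1 lt.2 /= => -> // /(_ isT).
Qed.

(** By injectivity the image of the path cannot turn back, so the direction of the first edge is
    kept throughout. *)
Lemma path_automorphism (f : 'I_n -> 'I_n) : injective f ->
  (forall p q, q = p.+1 :> nat -> f q = (f p).+1 :> nat \/ f p = (f q).+1 :> nat) ->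
  (forall p, f p = p) \/ (forall p, f p = rev_ord p).
Proof.
move=> f_inj adj; have [n1|n1] := leqP n 1.
  left => p; apply: val_inj => /=; have := ltn_ord (f p); have := ltn_ord p; lia.
pose o0 : 'I_n := Ordinal (ltnW n1); pose o1 : 'I_n := Ordinal n1.
have step p q r : q = p.+1 :> nat -> r = q.+1 :> nat ->
    (f q = (f p).+1 :> nat -> f r = (f q).+1 :> nat) /\
    (f p = (f q).+1 :> nat -> f q = (f r).+1 :> nat).
  move=> pq qr; have ne : (f p != f r :> nat).
    by rewrite val_eqE (inj_eq f_inj) -val_eqE /=; lia.
  by have := adj _ _ pq; have := adj _ _ qr; lia.
have prev (k : nat) (p : 'I_n) : p = k.+1 :> nat -> exists q : 'I_n, q = k :> nat.
  move=> pk; have kn : (k < n)%N by rewrite -pk ltnW.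
  by exists (Ordinal kn).
have eq0 (p : 'I_n) : p = 0 :> nat -> p = o0 by move=> p0; apply: val_inj.
have eq1 (p : 'I_n) : p = 1 :> nat -> p = o1 by move=> p0; apply: val_inj.
have up : f o1 = (f o0).+1 :> nat -> forall (k : nat) (p : 'I_n), p = k :> nat ->
    f p = (f o0 + k)%N :> nat.
  move=> h0; have two (k : nat) : forall p q : 'I_n, p = k :> nat -> q = k.+1 :> nat ->
      f q = (f p).+1 :> nat.
    elim: k => [|k IH] p q pk qk; first by rewrite (eq0 p) // (eq1 q).
    have [r rk] := prev _ _ pk.
    by apply: (step r p q _ _).1; [rewrite pk rk|rewrite qk pk|exact: IH].
  elim=> [|k IH] p pk; first by rewrite addn0 (eq0 p).
  by have [r rk] := prev _ _ pk; rewrite (two k r p) // IH // addnS.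
have down : f o0 = (f o1).+1 :> nat -> forall (k : nat) (p : 'I_n), p = k :> nat ->
    (f p + k)%N = f o0 :> nat.
  move=> h0; have two (k : nat) : forall p q : 'I_n, p = k :> nat -> q = k.+1 :> nat ->
      f p = (f q).+1 :> nat.
    elim: k => [|k IH] p q pk qk; first by rewrite (eq0 p) // (eq1 q).
    have [r rk] := prev _ _ pk.
    by apply: (step r p q _ _).2; [rewrite pk rk|rewrite qk pk|exact: IH].
  elim=> [|k IH] p pk; first by rewrite addn0 (eq0 p).
  by have [r rk] := prev _ _ pk; rewrite -(IH r) // (two k r p) // addSnnS.
(* The images of both ends of the path are less than [n], which fixes [f o0]. *)
have hl : (n.-1 < n)%N by rewrite ltn_predL ltnW.
have H0 := ltn_ord (f (Ordinal hl)); have H1 := ltn_ord (f o0).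
case: (adj o0 o1 erefl) => [/up h|/down h]; have H := h _ (Ordinal hl) erefl;
  [left|right] => p; apply: val_inj => /=; have := h _ p erefl; have := ltn_ord p; rewrite /=.
  by move: H H0 H1; rewrite /=; move: (nat_of_ord p) (nat_of_ord (f p)) (nat_of_ord (f o0)) (nat_of_ord (f _)); clear -n1; lia.
by move: H H0 H1; rewrite /=; move: (nat_of_ord p) (nat_of_ord (f p)) (nat_of_ord (f o0)) (nat_of_ord (f _)); clear -n1; lia.
Qed.

End Precedence.

(** * Linear maps preserving the rays *)

Section Monomial.
Variables (R : realType) (n : nat) (s1 s2 : n.-1.-tuple bool).
Variable g : {linear 'rV[R]_n -> 'rV[R]_n}.
Hypothesis g_inj : injective g.
Local Notation b := (boundary R).
Local Notation d m := (delta_mx 0 m : 'rV[R]_n).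
Hypothesis g_fam : forall S, S \in fam s1 -> (exists m : 'I_n, change S m) ->
  exists S' (l : R), [/\ S' \in fam s2, exists m : 'I_n, change S' m, 0 < l &
    g (b S) = l *: b S'].
Implicit Types (S T : {set 'I_n.+1}) (m p q r : 'I_n).

(* The images of the two opposite rays of [d m] are opposite rays, and two opposite members of
   [fam s2] have a single change: between two changes both would be equal to the word of lower
   vertices. *)
Lemma image_delta m : exists mc : 'I_n * R, mc.2 != 0 /\ g (d m) = mc.2 *: d mc.1.
Proof.
have e0 : d m 0 m != 0 by rewrite delta_entry eqxx oner_eq0.
have [|S [l [hS [p hp] l0 e]]] := g_fam (initial_fam s1 m).
  by exists m; rewrite -(boundary_neq0 R) boundary_initial.
have [|T [l' [hT _ l'0 e']]] := g_fam (initialC_fam s1 m).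
  by exists m; rewrite -(boundary_neq0 R) boundary_setC boundary_initial mxE oppr_eq0.
rewrite boundary_initial in e; rewrite boundary_setC boundary_initial linearN e in e'.
have ent r : l * b S 0 r = - (l' * b T 0 r).
  by move/rowP/(_ r): e'; rewrite !mxE => <-; rewrite opprK.
have chT r : change S r -> change T r.
  rewrite -!(boundary_neq0 R); apply: contraNneq => z.
  by move: (ent r); rewrite z mulr0 oppr0 => /eqP; rewrite mulf_eq0 (gt_eqF l0).
have uniq (r t : 'I_n) : change S r -> change S t -> ~ (r < t)%N.
  move=> hr ht rt; have hk : (r < r.+1 <= t)%N by rewrite ltnSn.
  have := fam_between hS hr ht (ltn_ord t) hk.
  rewrite -(fam_between hT (chT _ hr) (chT _ ht) (ltn_ord t) hk) => eS.
  have := ent r; have := chT _ hr; move: hr; rewrite /change !boundaryE eS.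
  case: (letter S r) => /=; case: (letter T r) => /=; case: (letter T r.+1) => //= _ _; lra.
exists (p, l * b S 0 p); split => /=.
  by apply: mulf_neq0; rewrite ?boundary_neq0 ?gt_eqF.
rewrite e -scalerA; congr (_ *: _); apply/rowP => r; rewrite [RHS]mxE delta_entry.
have [->|rp] := eqVneq r p; first by rewrite mulr1.
rewrite mulr0; apply/eqP; rewrite -[_ == _]negbK boundary_neq0; apply/negP => hr.
by case: (ltngtP r p) (rp) => [/(uniq _ _ hr hp)|/(uniq _ _ hp hr)|/val_inj ->] //; rewrite eqxx.
Qed.

Variables (f : 'I_n -> 'I_n) (c : 'I_n -> R).
Hypothesis c_neq0 : forall m, c m != 0.
Hypothesis g_delta : forall m, g (d m) = c m *: d (f m).

Lemma f_inj : injective f.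
Proof.
move=> p q fpq; have : g (c q *: d p - c p *: d q) = g 0.
  by rewrite linearB !linearZ /= !g_delta fpq ?scalerN !scalerA mulrC subrr linear0.
move=> /g_inj /rowP /(_ p); rewrite !mxE !eqxx /= mulr1.
have [//|pq] := eqVneq p q; rewrite mulr0 subr0 => /eqP.
by rewrite (negPf (c_neq0 _)).
Qed.

Lemma g_entry v m : g v 0 (f m) = c m * v 0 m.
Proof.
rewrite [in LHS](row_sum_delta v) linear_sum summxE (bigD1 m) //= big1.
  by rewrite linearZ g_delta !mxE !eqxx addr0 mulr1 mulrC.
move=> k km; rewrite linearZ g_delta !mxE (inj_eq f_inj) eq_sym.
by rewrite (negPf km) andbF !mulr0.
Qed.

Lemma image_change S T (l : R) m : 0 < l -> g (b S) = l *: b T ->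
  change T (f m) = change S m.
Proof.
move=> l0 e; rewrite -!(boundary_neq0 R); have := g_entry (b S) m.
rewrite e mxE => h; have -> : (b T 0 (f m) != 0) = (l * b T 0 (f m) != 0).
  by rewrite mulf_eq0 (gt_eqF l0).
by rewrite h mulf_eq0 (negPf (c_neq0 _)).
Qed.

Lemma f_surj r : exists m, f m = r.
Proof. by have [h _ fh] := injF_bij f_inj; exists (h r). Qed.

(** The image has the changes [f p] and [f q], so its first and last changes differ and determine it
    by [boundary_zigzag]. *)
Lemma image_zigzag p q : (p < q)%N -> exists p' q' (l : R),
  [/\ (p' < q')%N, 0 < l & g (b (zigzag s1 p q)) = l *: b (zigzag s2 p' q')].
Proof.
move=> pq; have [|S [l [hS _ l0 e]]] := g_fam (zigzag_fam s1 pq).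
  by exists p; apply: change_zigzagl.
have hp : change S (f p) by rewrite (image_change _ l0 e) change_zigzagl.
have hq : change S (f q) by rewrite (image_change _ l0 e) change_zigzagr.
case: (arg_minnP (fun m : 'I_n => m : nat) (hp : (fun m : 'I_n => change S m) (f p))) => p' hp' minp.
case: (arg_maxnP (fun m : 'I_n => m : nat) (hp : (fun m : 'I_n => change S m) (f p))) => q' hq' maxq.
have fpq : f p != f q :> nat by rewrite val_eqE (inj_eq f_inj) -val_eqE /= ltn_eqF.
have pq' : (p' < q')%N.
  have h1 : (p' <= f p)%N := minp _ hp; have h2 : (p' <= f q)%N := minp _ hq.
  have h3 : (f p <= q')%N := maxq _ hp; have h4 : (f q <= q')%N := maxq _ hq.
  by lia.
exists p', q', l; split => //; rewrite e; congr (_ *: _).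
apply: (boundary_zigzag R hS pq' hp' hq') => m hm; apply/andP; split; [exact: minp|exact: maxq].
Qed.

(* [image_zigzag] defines an injective map of the finite set of pairs [p < q] to itself. *)
Lemma zigzag_image p q : (p < q)%N -> exists p' q' (l : R),
  [/\ (p' < q')%N, 0 < l & g (b (zigzag s1 p' q')) = l *: b (zigzag s2 p q)].
Proof.
move=> pq; pose T := {x : 'I_n * 'I_n | (x.1 < x.2)%N}.
have ex (x : T) : exists y : T, exists2 l : R, 0 < l &
    g (b (zigzag s1 (val x).1 (val x).2)) = l *: b (zigzag s2 (val y).1 (val y).2).
  case: x => -[x y] /= xy; have [x' [y' [l [xy' l0 e]]]] := image_zigzag xy.
  by exists (exist _ (x', y') xy'), l.
have [h hP] := choice ex.
have h_inj : injective h.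
  move=> x y hxy; have [l l0 e] := hP x; have [l' l0' e'] := hP y.
  rewrite -hxy in e'; apply: val_inj.
  have [|e1 e2] := @zigzag_inj _ s1 _ _ _ _ (valP x) (valP y); last first.
    by case: (val x) (val y) e1 e2 => [? ?] [? ?] /= -> ->.
  by move=> m; rewrite -(image_change _ l0 e) -(image_change _ l0' e').
have [h' _ hh'] := injF_bij h_inj.
pose t : T := exist _ (p, q) pq; have [l l0] := hP (h' t); rewrite hh' /= => e.
by exists (val (h' t)).1, (val (h' t)).2, l; split => //; exact: (valP (h' t)).
Qed.

(* The nonzero entries of a boundary alternate in sign. *)
Lemma c_step p q : q = p.+1 :> nat -> c p = c q.
Proof.
move=> qp; have pq : (p < q)%N by rewrite qp.
have ne : p != q by rewrite -val_eqE /= ltn_eqF.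
have zp := change_zigzagl s1 pq; have zq := change_zigzagr s1 pq.
have out m : m != p -> m != q -> ~~ change (zigzag s1 p q) m.
  by rewrite -!val_eqE /= => mp mq; apply/negP => /(change_zigzag_out pq); lia.
have [|S [l [hS _ l0 e]]] := g_fam (zigzag_fam s1 pq); first by exists p.
have e1 := two_changes R ne zp zq out.
have e2 : b S 0 (f q) = - b S 0 (f p).
  apply: two_changes; rewrite ?(inj_eq f_inj) ?(image_change _ l0 e) //.
  move=> r; have [m <-] := f_surj r.
  by rewrite !(inj_eq f_inj) (image_change _ l0 e); exact: out.
have := g_entry (b (zigzag s1 p q)) p; have := g_entry (b (zigzag s1 p q)) q.
have sc r : (l *: b S) 0 r = l * b S 0 r by rewrite mxE.
rewrite e !sc e1 e2 !mulrN => /oppr_inj -> /mulIf h.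
by apply/esym/h; rewrite boundary_neq0.
Qed.

Lemma c_const : exists2 C : R, C != 0 & forall m, c m = C.
Proof.
case: (posnP n) => [n0|n0].
  by exists 1 => [|m]; [exact: oner_neq0|have := ltn_ord m; rewrite [X in (_ < X)%N]n0].
exists (c (Ordinal n0)) => // m.
suff h (k : nat) : forall m, m = k :> nat -> c m = c (Ordinal n0) by exact: (h m).
elim: k => [|k IH] {}m mk; first by congr c; exact: val_inj.
have kn : (k < n)%N by rewrite -mk ltnW.
by rewrite -(@c_step (Ordinal kn)) // IH.
Qed.

(** * The order on positions under the monomial map *)

Variable C : R.
Hypotheses (C_neq0 : C != 0) (cC : forall m, c m = C).
Local Notation prec := (precedes R).

Lemma image_unit_diff p q : g (d q - d p) = C *: (d (f q) - d (f p)).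
Proof. by rewrite linearB !g_delta !cC scalerBr. Qed.

Lemma unit_diff_entry p q : p != q -> (d q - d p) 0 q = 1.
Proof. by move=> pq; rewrite !mxE !eqxx (eq_sym q p) (negPf pq) subr0. Qed.

Lemma unit_diff_change S p q (a : R) : p != q -> a != 0 -> b S = a *: (d q - d p) ->
  [/\ change S p, change S q & forall m, change S m -> (m == p) || (m == q)].
Proof.
move=> pq a0 e; have ent m : b S 0 m = a * ((m == q)%:R - (m == p)%:R).
  by rewrite e !mxE !eqxx.
split; first by rewrite -(boundary_neq0 R) ent (negPf pq) eqxx mulf_neq0 // sub0r oppr_eq0 oner_eq0.
  by rewrite -(boundary_neq0 R) ent (eq_sym q p) (negPf pq) eqxx mulf_neq0 // subr0 oner_eq0.
move=> m; rewrite -(boundary_neq0 R) ent; apply: contraNT; rewrite negb_or.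
by case/andP => /negPf -> /negPf ->; rewrite subrr mulr0.
Qed.

(** Nonzero entries of a boundary have absolute value 1, so the scaling factor disappears and only
    the sign of [C] remains. *)
Lemma precedes_image p q : p != q -> prec s1 p q ->
  if 0 < C then prec s2 (f p) (f q) else prec s2 (f q) (f p).
Proof.
move=> pq [S hS e]; have e1 : b S = 1 *: (d q - d p) by rewrite scale1r.
have [hp hq _] := unit_diff_change pq (oner_neq0 _) e1.
have [|T [l [hT _ l0 eT]]] := g_fam hS; first by exists p.
rewrite e image_unit_diff in eT.
have fpq : f p != f q by rewrite (inj_eq f_inj).
have eT' : b T = (l^-1 * C) *: (d (f q) - d (f p)).
  by rewrite -scalerA eT scalerA mulVf ?scale1r // gt_eqF.
have lC0 : l^-1 * C != 0 by rewrite mulf_neq0 // invr_eq0 gt_eqF.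
have [_ hTq _] := unit_diff_change fpq lC0 eT'.
have : `|l^-1 * C| = 1.
  have := boundary_norm R hTq.
  by rewrite eT' [X in `|X| = _ -> _]mxE unit_diff_entry // mulr1.
case: ltP => hC.
  rewrite gtr0_norm ?mulr_gt0 ?invr_gt0 // => lC; exists T => //.
  by rewrite eT' lC scale1r.
have {}hC : C < 0 by rewrite lt_neqAle C_neq0.
rewrite ltr0_norm ?pmulr_rlt0 ?invr_gt0 // => lC; exists T => //.
by rewrite eT' -[l^-1 * C]opprK lC scaleN1r opprB.
Qed.

(** As [g_fam] only leads from [s1] to [s2], the ray of [s1] above a given ray is supplied by
    [zigzag_image]. *)
Lemma precedes_preimage p q : p != q ->
  (if 0 < C then prec s2 (f p) (f q) else prec s2 (f q) (f p)) -> prec s1 p q.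
Proof.
move=> pq h; have fpq : f p != f q by rewrite (inj_eq f_inj).
(* Here [a] is the sign of [C]. *)
have [T hT [a [a1 aC eT]]] : exists2 T, T \in fam s2 & exists a : R,
    [/\ `|a| = 1, 0 < a / C & b T = a *: (d (f q) - d (f p))].
  move: h; case: ltP => hC [T hT eT]; exists T => //.
    by exists 1; rewrite normr1 scale1r div1r invr_gt0.
  exists (-1); rewrite normrN normr1 eT scaleN1r opprB; split => //.
  by rewrite mulN1r oppr_gt0 invr_lt0 lt_neqAle C_neq0.
have a0 : a != 0 by rewrite -normr_gt0 a1.
have [hp hq out] := unit_diff_change fpq a0 eT.
have [u [v [uv eu ev]]] : exists u v : 'I_n, [/\ (u < v)%N, change T u /\ change T v &
    forall m, change T m -> (u <= m <= v)%N].
  move: fpq; rewrite -val_eqE /= neq_ltn => /orP [lt|lt].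
    exists (f p), (f q); split => // m /out /orP [] /eqP ->; rewrite leqnn (ltnW lt) //.
  exists (f q), (f p); split => // m /out /orP [] /eqP ->; rewrite leqnn (ltnW lt) //.
have eZ := boundary_zigzag R hT uv eu.1 eu.2 ev.
have [p' [q' [l [pq' l0 e]]]] := zigzag_image uv.
rewrite -eZ eT scalerA in e.
have {}e : b (zigzag s1 p' q') = (l * (a / C)) *: (d q - d p).
  apply: g_inj; rewrite e linearZ image_unit_diff /= scalerA; congr (_ *: _).
  by rewrite mulrA divfK.
have lC0 : 0 < l * (a / C) by rewrite mulr_gt0.
exists (zigzag s1 p' q'); first exact: zigzag_fam.
have [_ hq' _] := unit_diff_change pq (lt0r_neq0 lC0) e.
have := boundary_norm R hq'; rewrite {1}e [X in `|X| = _ -> _]mxE unit_diff_entry // mulr1.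
by rewrite gtr0_norm // e => ->; rewrite scale1r.
Qed.

(** Adjacent positions are comparable with nothing in between. If their images were not adjacent,
    [precedes_chain] would give an element between these, and its preimage would contradict
    [precedes_cover]. *)
Lemma f_adjacent p q : q = p.+1 :> nat -> f q = (f p).+1 :> nat \/ f p = (f q).+1 :> nat.
Proof.
move=> qp; have pq : p != q by rewrite -val_eqE /= qp ltn_eqF.
have fpq : f p != f q :> nat by rewrite val_eqE (inj_eq f_inj).
have key (x y : 'I_n) : y = x.+1 :> nat \/ x = y.+1 :> nat -> x != y -> prec s1 x y ->
    ~ ((f x).+1 < f y \/ (f y).+1 < f x)%N.
  move=> adj xy hxy lt; have h := precedes_image xy hxy.
  have [r [rx ry h1 h2]] : exists r, [/\ r != x, r != y, prec s1 x r & prec s1 r y].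
    suff [r [rx ry h']] : exists r, [/\ f r != f x, f r != f y &
      if 0 < C then prec s2 (f x) (f r) /\ prec s2 (f r) (f y)
      else prec s2 (f y) (f r) /\ prec s2 (f r) (f x)].
      rewrite !(inj_eq f_inj) in rx ry; exists r; split => //.
        by apply: precedes_preimage; [rewrite eq_sym|move: h'; case: ifP => _ []].
      by apply: precedes_preimage => //; move: h'; case: ifP => _ [].
    move: h; case: ifP => _ /precedes_chain [].
    - by case: lt => ?; [left|right].
    - by move=> z [? ? ? ?]; have [r rz] := f_surj z; exists r; rewrite rz.
    - by case: lt => ?; [right|left].
    - by move=> z [? ? ? ?]; have [r rz] := f_surj z; exists r; rewrite rz.
  exact: precedes_cover adj rx ry h1 h2.
have [hpq|hqp] : prec s1 p q \/ prec s1 q p.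
  have lt : (p < q)%N by rewrite qp.
  case E : (is_lower s1 q); [left; apply: (precedesP R s1 true lt).2|
    right; apply: (precedesP R s1 false lt).2] => k hk; rewrite -E; congr is_lower; lia.
  by have := key p q (or_introl qp) pq hpq; lia.
by have := key q p (or_intror qp) _ hqp; rewrite eq_sym => /(_ pq); lia.
Qed.

Lemma sign_precedes s p q (t : bool) : q = p.+1 :> nat ->
  (if t then prec s p q else prec s q p) <-> nth true s p = ~~ t.
Proof.
move=> qp; have lt : (p < q)%N by rewrite qp.
have e : is_lower s q = ~~ nth true s p by rewrite /is_lower qp.
apply: (iff_trans (precedesP R s t lt)); split=> [/(_ q)|h k hk].
  by rewrite lt leqnn e => /(_ isT) <-; rewrite negbK.
by rewrite (_ : k = q) ?e ?h ?negbK //; lia.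
Qed.

(** The entries of the sign sequence orient the edges of the path. Reversing the path reverses the
    entries and also flips every orientation; a negative [C] flips every orientation once more. This
    gives the four cases. *)
Lemma monomial_obtained_from : obtained_from s1 s2.
Proof.
have nth_s (s : n.-1.-tuple bool) : size s = n.-1 by exact: size_tuple.
have tuple_ext (s t : n.-1.-tuple bool) :
    (forall p q, q = p.+1 :> nat -> nth true s p = nth true t p) -> s = t.
  move=> h; apply/val_inj/(@eq_from_nth _ true); rewrite !nth_s // => i hi.
  have i1 : (i < n)%N by lia.
  have i2 : (i.+1 < n)%N by lia.
  exact: (h (Ordinal i1) (Ordinal i2)).
have [fE|fE] := path_automorphism f_inj f_adjacent.
  have h p q t : q = p.+1 :> nat -> nth true s1 p = ~~ t ->
      nth true s2 p = (t (+) (0 < C)).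
    move=> qp /(sign_precedes s1 t qp).2 h.
    have pq : p != q by rewrite -val_eqE /= qp ltn_eqF.
    have qp' : q != p by rewrite eq_sym.
    rewrite -[RHS]negbK; apply/(sign_precedes s2 _ qp).
    case: (t) h => [/(precedes_image pq)|/(precedes_image qp')]; rewrite !fE; by case: ifP.
  case: (ltP 0 C) h => _ h.
    suff -> : s2 = s1 by constructor.
    apply: tuple_ext => p q qp; rewrite (h p q (~~ nth true s1 p) qp) ?negbK //.
    by rewrite addbT negbK.
  suff -> : s2 = reflection s1 by do 2!constructor.
  apply: tuple_ext => p q qp; rewrite (h p q (~~ nth true s1 p) qp) ?negbK //.
  rewrite addbF (nth_map true) // nth_s; have := ltn_ord q; lia.
have h p q r t : q = p.+1 :> nat -> r = rev_ord q ->
    nth true s1 p = ~~ t -> nth true s2 r = ~~ (t (+) (0 < C)).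
  move=> qp -> /(sign_precedes s1 t qp).2 h.
  have pq : p != q by rewrite -val_eqE /= qp ltn_eqF.
  have qp' : q != p by rewrite eq_sym.
  have rqp : rev_ord p = (rev_ord q).+1 :> nat by rewrite /= qp; have := ltn_ord q; lia.
  apply/(sign_precedes s2 _ rqp).
  case: (t) h => [/(precedes_image pq)|/(precedes_image qp')]; rewrite !fE; by case: ifP.
have rev_nth p q : q = p.+1 :> nat -> nth true (rev s1) p = nth true s1 (rev_ord q).
  move=> qp; rewrite nth_rev nth_s; last by have := ltn_ord q; lia.
  by congr nth; rewrite /= qp; have := ltn_ord q; lia.
have h' p q : q = p.+1 :> nat -> nth true s2 p = nth true (rev s1) p (+) (0 < C).
  move=> qp; rewrite (rev_nth p q qp).
  have rqp : rev_ord p = (rev_ord q).+1 :> nat by rewrite /= qp; have := ltn_ord q; lia.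
  rewrite (h _ _ p (~~ nth true s1 (rev_ord q)) rqp) ?rev_ordK ?negbK //.
  by rewrite addNb negbK.
case: (ltP 0 C) h' => _ h'.
  suff -> : s2 = reflection (reversal s1) by do 3!constructor.
  apply: tuple_ext => p q qp; rewrite (h' p q qp) addbT (nth_map true) //.
  by rewrite size_rev nth_s; have := ltn_ord q; lia.
suff -> : s2 = reversal s1 by do 2!constructor.
by apply: tuple_ext => p q qp; rewrite (h' p q qp) addbF.
Qed.

End Monomial.

(** * Coordinates on the dual space *)

Section Coordinates.
Variables (R : realType) (n : nat) (D : {pred {set 'I_n.+1}}).
Variable U : {vspace 'rV[R]_n.+1}.
Hypothesis hU : is_direction_space (@removahedron R n D) U.
Implicit Types (c : dual_space U) (S : {set 'I_n.+1}).

(** The direction is chosen so that these vectors are dual to the normals of the initial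
    segments. *)
Definition simple_root (k : nat) : 'rV[R]_n.+1 := unit_diff R (inord k.+1) (inord k).

Definition coordinates c : 'rV[R]_n :=
  \row_m (c : 'Hom(subvs_of U, R^o)) (vsproj U (simple_root m)).

Fact coordinates_linear : linear coordinates.
Proof. by move=> a c c'; apply/rowP => m; rewrite !mxE add_lfunE scale_lfunE. Qed.
HB.instance Definition _ :=
  GRing.isLinear.Build R (dual_space U) 'rV[R]_n _ coordinates coordinates_linear.

Lemma coordinates_facet_normal S : coordinates (facet_normal U S) = boundary R S.
Proof.
apply/rowP => m; rewrite !mxE facet_normalE; last exact/unit_diff_direction/hU.1.
by rewrite sumS_unit_diff opprB.
Qed.

Lemma coordinates_inj : injective coordinates.
Proof.
move=> c c' /rowP e.
have cD (h : 'Hom(subvs_of U, R^o)) i j k : h (vsproj U (unit_diff R i k)) =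
    h (vsproj U (unit_diff R i j)) + h (vsproj U (unit_diff R j k)).
  by rewrite (unit_diff_trans R i j) !linearD.
have base_eq (i : 'I_n.+1) :
    (c : 'Hom(subvs_of U, R^o)) (vsproj U (unit_diff R i ord0)) =
    (c' : 'Hom(subvs_of U, R^o)) (vsproj U (unit_diff R i ord0)).
  rewrite -[i]inord_val; elim: (nat_of_ord i) (ltn_ord i) => [|k IH] kn.
    by rewrite (_ : inord 0 = ord0) ?/unit_diff ?subrr ?linear0 //; apply: val_inj; rewrite /= inordK.
  rewrite (cD c _ (inord k)) (cD c' _ (inord k)) IH ?(ltnW kn) //.
  by congr (_ + _); have := e (Ordinal (kn : (k < n)%N)); rewrite !mxE.
apply: (functional_eq hU) => i j.
rewrite (cD c i ord0) (cD c' i ord0) base_eq (unit_diffN R j) !linearN /=.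
by congr (_ - _); exact: base_eq.
Qed.

Definition of_coordinates (v : 'rV[R]_n) : dual_space U :=
  \sum_m v 0 m *: facet_normal U (initial n m).

Fact of_coordinates_linear : linear of_coordinates.
Proof.
move=> a v w; rewrite /of_coordinates scaler_sumr -big_split /=.
by apply: eq_bigr => m _; rewrite !mxE scalerDl scalerA.
Qed.
HB.instance Definition _ :=
  GRing.isLinear.Build R 'rV[R]_n (dual_space U) _ of_coordinates of_coordinates_linear.

Lemma of_coordinatesK : cancel of_coordinates coordinates.
Proof.
move=> v; rewrite linear_sum [RHS]row_sum_delta; apply: eq_bigr => m _.
by rewrite linearZ /= coordinates_facet_normal boundary_initial.
Qed.

Lemma coordinatesK : cancel coordinates of_coordinates.
Proof. by move=> c; apply: coordinates_inj; rewrite of_coordinatesK. Qed.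

End Coordinates.

(** The half-line of a facet normal is sent to a normal cone of some face. By [facet_normal_in_cone]
    this cone contains a facet normal, so the image is the half-line of that normal; in coordinates
    this is the hypothesis [g_fam] on the map [g]. *)
Lemma normally_isomorphic_obtained (R : realType) (n : nat) (s1 s2 : n.-1.-tuple bool) :
  normally_isomorphic (@removahedron R n (fam s1)) (@removahedron R n (fam s2)) ->
  obtained_from s1 s2.
Proof.
move=> [U [U' [hU hU' [f f_bij f_cone]]]].
have UU : U' = U by apply/vspaceP => x; rewrite (mem_direction hU) (mem_direction hU').
subst U'; have f_inj := bij_inj f_bij.
pose g (v : 'rV[R]_n) : 'rV[R]_n := coordinates (f (of_coordinates U v)).
have g_lin : linear g by move=> a v w; rewrite /g !linearP.
pose gL := HB.pack_for {linear 'rV[R]_n -> 'rV[R]_n} g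
  (GRing.isLinear.Build R 'rV[R]_n 'rV[R]_n _ g g_lin).
have g_inj : injective gL.
  move=> v w /(coordinates_inj hU) /f_inj e.
  by rewrite -(of_coordinatesK hU v) e (of_coordinatesK hU).
have normal_neq0 S : (exists m : 'I_n, change S m) -> facet_normal U S != 0.
  move=> [m hm]; apply/eqP => e; move: hm; rewrite -(boundary_neq0 R).
  by rewrite -(coordinates_facet_normal hU) e linear0 mxE eqxx.
have g_fam S : S \in fam s1 -> (exists m : 'I_n, change S m) ->
    exists S' (l : R), [/\ S' \in fam s2, exists m : 'I_n, change S' m, 0 < l &
      gL (boundary R S) = l *: boundary R S'].
  move=> hS chS; have /andP [S0 ST] := introT (nontrivialP S) chS.
  have [F hF eF] : normal_fan (U := U) (removahedron (fam s2))
      (f @` normal_cone (U := U) (removahedron (fam s1)) (facet (fam s1) S))%classic.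
    by apply: f_cone; exists (facet (fam s1) S) => //; exact: facet_is_face.
  rewrite (normal_cone_facet hU hS S0 ST) in eF.
  have c_in : normal_cone (U := U) (removahedron (fam s2)) F (f (facet_normal U S)).
    rewrite -eF; exists (facet_normal U S) => //.
    by exists 1; rewrite ?ler01 ?scale1r.
  have c0 : f (facet_normal U S) != 0.
    by rewrite -(linear0 f) (inj_eq f_inj) normal_neq0.
  have [S' [hS' S'0 S'T]] := facet_normal_in_cone hU' hF c_in c0.
  have chS' : exists m : 'I_n, change S' m by apply/nontrivialP; rewrite S'0.
  rewrite -eF => -[_ [a a0 ->]]; rewrite linearZ /= => e.
  have {}a0 : 0 < a.
    rewrite lt_neqAle a0 andbT eq_sym; apply: contraNneq (normal_neq0 _ chS') => z.
    by rewrite -e z scale0r.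
  (* The normal of [S'] is the image of [a] times that of [S], hence the inverse factor. *)
  exists S', a^-1; split; rewrite ?invr_gt0 //= /g.
  rewrite -(coordinates_facet_normal hU) (coordinatesK hU).
  by rewrite -(coordinates_facet_normal hU S') -e linearZ /= scalerA mulVf ?scale1r // gt_eqF.
have [fc hfc] := choice (image_delta g_fam).
pose pi m := (fc m).1; pose c m := (fc m).2.
have c_neq0 m : c m != 0 := (hfc m).1.
have g_delta m : gL (delta_mx 0 m) = c m *: delta_mx 0 (pi m) := (hfc m).2.
have [C C0 cC] := c_const g_inj g_fam c_neq0 g_delta.
by have := monomial_obtained_from g_inj g_fam c_neq0 g_delta C0 cC.
Qed.

Theorem theorem4p9 (R : realType) (n : nat) (hn : (1 <= n)%N)
    (s1 s2 : n.-1.-tuple bool) (p1 p2 : 'I_n.+3 -> 'rV[R]_2)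
    (hp1 : is_polygon s1 p1) (hp2 : is_polygon s2 p2) :
  normally_isomorphic (associahedron p1) (associahedron p2) <->
  obtained_from s1 s2.
Proof.
rewrite (associahedronE hn hp1) (associahedronE hn hp2).
by split; [exact: normally_isomorphic_obtained|exact: obtained_normally_isomorphic].
Qed.
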